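(* Let $M$ be an ordered matroid on $E$ and let $T$ be the maximum element of $L(M)$. Then there is a homotopy equivalence $$\Delta(M)\simeq IN(M^*|T),$$ and consequently $\tilde H_i(\Delta(M))\cong\tilde H_i(IN(M^*|T))$ for all $i\ge-1$.
   Context: An ordered matroid is a matroid on a finite set $E$ together with a linear order on $E$; $\mathcal B(M)$ is its set of bases. For $F\subseteq E$, $e\in E$ is active with respect to $F$ if there is a circuit $C\subseteq F\cup\{e\}$ with $e\in C$ and $e$ the minimum of $C$; $\mathrm{Act}_M(F)$ is the set of such $e$ (possibly $e\in F$), and $\mathrm{Ext}_M(F)=\mathrm{Act}_M(F)\setminus F$. The external order on $\mathcal B(M)$: $A\le B$ iff $A\subseteq B\cup\mathrm{Ext}_M(B)$; $L(M)$ is $\mathcal B(M)$ with this order and a new minimum $\hat0$ adjoined (a lattice). Its maximum element is $T=E\setminus\mathrm{Act}_M(E)$, the lexicographically maximum base of $M$. $\Delta(M)$ is the order complex of $L(M)$: the abstract simplicial complex on $L(M)\setminus\{\hat0,T\}$ whose faces are the nonempty chains. $M^*$ is the dual matroid of $M$, and $M^*|T$ its restriction to $T$. For a matroid $N$, $IN(N)$ is the independence complex: the simplicial complex whose faces are the nonempty independent sets of $N$. $\tilde H_i$ denotes reduced simplicial homology with coefficients in $\mathbb Z$. *)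

(* Defs.v *)
From HB Require Import structures.
From mathcomp Require Import all_boot all_order all_algebra ring boolp.

Set Implicit Arguments.
Unset Strict Implicit.
Unset Printing Implicit Defensive.

Import Order.TTheory GRing.Theory Num.Theory.

(* A matroid whose ground set is the whole finite type [E]. *)
Record matroid (E : finType) := Matroid {
  indep : pred {set E};
  indep0 : indep set0;
  indepS : forall A B : {set E}, A \subset B -> indep B -> indep A;
  indep_aug : forall A B : {set E}, indep A -> indep B -> #|A| < #|B| ->
    exists2 e, e \in B :\: A & indep (e |: A)
}.

Section MatroidTheory.
Variables (E : finType) (M : matroid E).
Implicit Types (A B C F I S : {set E}) (e : E).

Definition is_base B := maxset (indep M) B.
Definition circuit C := minset (fun A => ~~ indep M A) C.

Lemma base_indep B : is_base B -> indep M B.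
Proof. exact: maxsetp. Qed.

Lemma indep_card_base A B : indep M A -> is_base B -> #|A| <= #|B|.
Proof.
move=> iA bB; rewrite leqNgt; apply/negP => /(indep_aug (base_indep bB) iA).
case=> e; rewrite inE => /andP[eB _] ieB.
by move: eB; rewrite -(maxsetsup bB ieB (subsetUr _ _)) setU11.
Qed.

Lemma indep_extend A B : indep M A -> is_base B ->
  exists2 B', is_base B' & (A \subset B') && (B' \subset A :|: B).
Proof.
move=> iA bB; pose P := [pred I | indep M I && (I \subset A :|: B)].
have PA : P A by rewrite /= iA subsetUl.
have [I mI AI] := maxset_exists PA.
have /andP[iI IAB] : P I := maxsetp mI.
have leI : #|B| <= #|I|.
  rewrite leqNgt; apply/negP => /(indep_aug iI (base_indep bB)) [e].
  rewrite inE => /andP[eI eB] ieI.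
  have PeI : P (e |: I).
    by rewrite /= ieI subUset IAB andbT sub1set inE eB orbT.
  by move: eI; rewrite -(maxsetsup mI PeI (subsetUr _ _)) setU11.
exists I; last by rewrite AI.
apply/maxsetP; split=> // D iD ID; apply/eqP; rewrite eq_sym eqEcard ID.
exact: leq_trans (indep_card_base iD bB) leI.
Qed.

Lemma base_exists : exists B, is_base B.
Proof. by have [B bB _] := maxset_exists (indep0 M); exists B. Qed.

Lemma base_card A B : is_base A -> is_base B -> #|A| = #|B|.
Proof.
move=> bA bB; apply/eqP; rewrite eqn_leq.
by rewrite (indep_card_base (base_indep bA) bB)
           (indep_card_base (base_indep bB) bA).
Qed.

(* The dual matroid: its independent sets are the subsets of complements of
   bases, so that its bases are the complements of bases (see [base_dual]). *)
Definition dual_indep S := [exists B : {set E}, is_base B && (S \subset ~: B)].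

Lemma dual_indepP S :
  reflect (exists2 B, is_base B & [disjoint S & B]) (dual_indep S).
Proof.
apply: (iffP existsP) => [[B /andP[bB]]|[B bB]];
  by rewrite ?subsets_disjoint ?setCK => dSB; exists B;
     rewrite ?bB ?subsets_disjoint ?setCK.
Qed.

Lemma dual_indep0 : dual_indep set0.
Proof.
have [B bB] := base_exists; apply/existsP; exists B.
by rewrite bB sub0set.
Qed.

Lemma dual_indepS A B : A \subset B -> dual_indep B -> dual_indep A.
Proof.
move=> AB /existsP[I /andP[bI BI]]; apply/existsP; exists I.
by rewrite bI (subset_trans AB).
Qed.

Lemma dual_indep_aug A B : dual_indep A -> dual_indep B -> #|A| < #|B| ->
  exists2 e, e \in B :\: A & dual_indep (e |: A).
Proof.
move=> /dual_indepP[P bP dAP] /dual_indepP[Q bQ dBQ] ltAB.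
have iQA : indep M (Q :\: A) by apply: indepS (subsetDl _ _) (base_indep bQ).
have [D bD /andP[QD DQ]] := indep_extend iQA bP.
have dAD : [disjoint A & D].
  rewrite disjoint_sym disjoints_subset; apply: subset_trans DQ _.
  rewrite subUset; apply/andP; split.
    by rewrite setDE subsetIr.
  by rewrite -disjoints_subset disjoint_sym.
have [sBAD|] := boolP (B :\: A \subset D); last first.
  case/subsetPn=> e eBA eD; exists e => //; apply/dual_indepP; exists D => //.
  by rewrite disjoints_subset subUset sub1set inE eD -disjoints_subset.
exfalso; move: (base_card bD bQ); apply/eqP; rewrite gtn_eqF //.
have dQB : [disjoint Q :\: A & B :\: A].
  apply: disjointWl (subsetDl _ _) _; apply: disjointWr (subsetDl _ _) _.
  by rewrite disjoint_sym.
have : #|(Q :\: A) :|: (B :\: A)| <= #|D|.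
  by apply: subset_leq_card; rewrite subUset QD.
rewrite cardsU (disjoint_setI0 dQB) cards0 subn0.
apply: leq_trans; rewrite -(cardsID A Q) addnC ltn_add2l.
have sQA : Q :&: A \subset A :\: B.
  apply/subsetP=> x; rewrite !inE => /andP[xQ ->]; rewrite andbT.
  by apply: contraL xQ => xB; rewrite (disjointFr dBQ).
apply: leq_ltn_trans (subset_leq_card sQA) _.
by rewrite -(ltn_add2l #|A :&: B|) cardsID setIC cardsID.
Qed.

Definition dual_matroid : matroid E :=
  Matroid dual_indep0 dual_indepS dual_indep_aug.

Variable T : {set E}.

(* The restriction to [T], with ground set the subtype of elements of [T]. *)
Definition restr_indep (S : {set {x : E | x \in T}}) := indep M (val @: S).

Lemma restr_indep0 : restr_indep set0.
Proof. by rewrite /restr_indep imset0 indep0. Qed.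

Lemma restr_indepS (A B : {set {x : E | x \in T}}) :
  A \subset B -> restr_indep B -> restr_indep A.
Proof. by move=> AB; apply: indepS; apply: imsetS. Qed.

Lemma restr_indep_aug (A B : {set {x : E | x \in T}}) :
  restr_indep A -> restr_indep B -> #|A| < #|B| ->
  exists2 e, e \in B :\: A & restr_indep (e |: A).
Proof.
move=> iA iB; rewrite -(card_imset _ val_inj).
rewrite -[X in _ < X](card_imset _ val_inj) => /(indep_aug iA iB)[e]; rewrite inE => /andP[eA /imsetP[x xB ex]] ieA.
exists x; last by rewrite /restr_indep imsetU1 -ex.
by rewrite inE xB andbT; apply: contra eA => xA; rewrite ex imset_f.
Qed.

Definition restr_matroid : matroid {x : E | x \in T} :=
  Matroid restr_indep0 restr_indepS restr_indep_aug.

End MatroidTheory.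

Definition base (E : finType) (M : matroid E) := {B : {set E} | is_base M B}.

Lemma base_dual (E : finType) (M : matroid E) (B : {set E}) :
  is_base (dual_matroid M) B = is_base M (~: B).
Proof.
apply/idP/idP => [bB|bB].
  have /existsP[D /andP[bD BD]] := base_indep bB.
  have iD : dual_indep M (~: D) by apply/existsP; exists D; rewrite bD subxx.
  by rewrite -(maxsetsup bB iD BD) setCK.
apply/maxsetP; split=> /= [|D /existsP[I /andP[bI DI]] BD].
  by apply/existsP; exists (~: B); rewrite bB setCK subxx.
apply/eqP; rewrite eq_sym eqEsubset BD /=; apply: subset_trans (DI) _.
suff -> : I = ~: B by rewrite setCK.
apply/eqP; rewrite eqEcard (base_card bB bI) leqnn andbT.
by rewrite -[I]setCK setCS (subset_trans BD DI).
Qed.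

Section Activity.
Variables (d : Order.disp_t) (E : finOrderType d) (M : matroid E).
Implicit Types (A B C F G I J : {set E}) (e : E).

Definition active F e := [exists C : {set E},
  [&& circuit M C, C \subset e |: F, e \in C & [forall x in C, (e <= x)%O]]].
Definition Act F := [set e | active F e].
Definition Ext F := Act F :\: F.

Definition ext_le A B := A \subset B :|: Ext B.

(* Matroid closure, only used to show that the external order is an order with
   a maximum. *)
Let cl F := F :|: [set e |
  [exists I : {set E}, [&& I \subset F, indep M I & ~~ indep M (e |: I)]]].

Let gt F e := [set x in F | (e < x)%O].

Let in_cl F e : reflect (e \in F \/ exists I : {set E},
  [/\ I \subset F, indep M I & ~~ indep M (e |: I)]) (e \in cl F).
Proof.
rewrite !inE; apply: (iffP orP) => -[->|]; [by left| |by left|].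
  by move=> /existsP[I /and3P[? ? ?]]; right; exists I.
by case=> I [? ? ?]; right; apply/existsP; exists I; apply/and3P.
Qed.

Let sub_cl F : F \subset cl F. Proof. exact: subsetUl. Qed.

Let clS F G : F \subset G -> cl F \subset cl G.
Proof.
move=> FG; apply/subsetP => e /in_cl[eF|[I [IF iI dI]]]; apply/in_cl.
  by left; apply: (subsetP FG).
by right; exists I; split=> //; apply: subset_trans FG.
Qed.

Let max_in F I :=
  [/\ I \subset F, indep M I & forall x, x \in F -> indep M (x |: I) -> x \in I].

Let max_in_ex F J : J \subset F -> indep M J ->
  exists2 I, max_in F I & J \subset I.
Proof.
move=> JF iJ; pose P := [pred I | indep M I && (I \subset F)].
have PJ : P J by rewrite /= iJ.
have [I mI JI] := maxset_exists PJ.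
have /andP[iI IF] : P I := maxsetp mI.
exists I => //; split=> // x xF ixI.
have <- : x |: I = I; last exact: setU11.
by apply: (maxsetsup mI); rewrite ?subsetUr //= ixI subUset sub1set xF.
Qed.

Let max_in_card F I J : max_in F I -> J \subset F -> indep M J -> #|J| <= #|I|.
Proof.
move=> [IF iI mI] JF iJ; rewrite leqNgt; apply/negP => /(indep_aug iI iJ)[e].
by rewrite inE => /andP[/negP eI eJ] ieI; apply/eI/mI => //; apply: (subsetP JF).
Qed.

Let max_in_cl F I e : max_in F I -> e \in cl F -> indep M (e |: I) -> e \in I.
Proof.
move=> mI /in_cl[eF|[J0 [J0F iJ0 dJ0]]]; first by case: mI => _ _; apply.
move=> ieI; have [J mJ J0J] := max_in_ex J0F iJ0.
apply: contraT => eI; have [JF iJ maxJ] := mJ.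
have ltJ : #|J| < #|e |: I| by rewrite cardsU1 eI ltnS (max_in_card mI).
have [x] := indep_aug iJ ieI ltJ; rewrite !inE => /andP[xJ].
case/predU1P => [-> ixJ|xI ixJ].
  by case/negP: dJ0; apply: indepS (setUS _ J0J) ixJ.
by case/negP: xJ; apply: maxJ => //; case: mI => /subsetP/(_ _ xI).
Qed.

Let cl_trans F G : F \subset cl G -> cl F \subset cl G.
Proof.
move=> FG; apply: subset_trans (clS FG) _; apply/subsetP => e eG.
have [I mI _] := max_in_ex (sub0set G) (indep0 M).
have mcI : max_in (cl G) I.
  case: (mI) => IG iI _; split=> //; first exact: subset_trans (sub_cl G).
  by move=> x; apply: max_in_cl.
case: (mI) => IG iI _; apply/in_cl.
have [ieI|dI] := boolP (indep M (e |: I)); last by right; exists I.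
by left; apply: (subsetP IG); apply: (max_in_cl mcI eG).
Qed.

Let gtS F G e : F \subset G -> gt F e \subset gt G e.
Proof.
by move=> /subsetP FG; apply/subsetP=> x; rewrite !inE => /andP[/FG -> ->].
Qed.

Let in_Act F e : (e \in Act F) = (e \in cl (gt F e)).
Proof.
rewrite inE; apply/existsP/in_cl => [[C /and4P[cC CF eC /forall_inP minC]]|].
  right; exists (C :\ e); rewrite setD1K //; split.
  - apply/subsetP=> x; rewrite !inE => /andP[xe xC].
    rewrite lt_neqAle eq_sym xe minC // !andbT.
    by move: (subsetP CF _ xC); rewrite !inE (negPf xe).
  - apply: contraT => dC.
    by move: (setD11 e C); rewrite (minsetinf cC dC (subsetDl _ _)) eC.
  - exact: minsetp cC.
case=> [|[I [IF iI dI]]]; first by rewrite !inE ltxx andbF.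
have [C cC CI] := @minset_exists _ (fun A => ~~ indep M A) _ dI.
exists C; rewrite /circuit cC /=; apply/and3P; split.
- apply: subset_trans CI _; apply: setUS; apply: subset_trans IF _.
  by apply/subsetP=> x; rewrite inE => /andP[].
- apply: contraT => eC; case/negP: (minsetp cC); apply: indepS iI.
  apply/subsetP=> x xC; move: (subsetP CI _ xC); rewrite !inE.
  by case/predU1P => // xe; rewrite xe (negPf eC) in xC.
- apply/forall_inP=> x xC; move: (subsetP CI _ xC); rewrite !inE.
  by case/predU1P=> [->//|/(subsetP IF)]; rewrite inE => /andP[_ /ltW].
Qed.

Let sg F := F :|: Ext F.

Let in_sg F e : (e \in sg F) = (e \in F) || (e \in cl (gt F e)).
Proof. by rewrite -in_Act !inE; case: (e \in F). Qed.

Let sgS F G : F \subset G -> sg F \subset sg G.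
Proof.
move=> FG; apply/subsetP=> e; rewrite !in_sg => /orP[/(subsetP FG)->//|].
by move/(subsetP (clS (gtS e FG))) ->; rewrite orbT.
Qed.

Let gt_sg F e : gt (sg F) e \subset cl (gt F e).
Proof.
apply/subsetP=> x; rewrite inE in_sg => /andP[/orP[xF|xcl] ex].
  by apply: (subsetP (sub_cl _)); rewrite inE xF.
apply: (subsetP (clS _)) xcl; apply/subsetP=> y; rewrite !inE => /andP[-> xy].
exact: lt_trans xy.
Qed.

Let sg_idem F G : F \subset sg G -> sg F \subset sg G.
Proof.
move=> /sgS/subset_trans; apply; apply/subsetP=> e; rewrite in_sg => /orP[//|].
by move/(subsetP (cl_trans (gt_sg G e))); rewrite in_sg => ->; rewrite orbT.
Qed.

Let base_sg A : indep M A -> A = [set e in sg A | e \notin cl (gt (sg A) e)].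
Proof.
move=> iA; apply/setP=> e; rewrite inE in_sg.
have eqcl : cl (gt (sg A) e) = cl (gt A e).
  apply/eqP; rewrite eqEsubset cl_trans ?gt_sg //.
  by apply/clS/gtS/subsetUl.
rewrite eqcl; have [eA|//] := boolP (e \in A); last by case: (e \in cl _).
symmetry; apply/negP => /in_cl[|[I [IA _ /negP[]]]].
  by rewrite inE ltxx andbF.
apply: indepS iA; rewrite subUset sub1set eA; apply: subset_trans IA _.
by apply/subsetP=> x; rewrite inE => /andP[].
Qed.

Lemma ext_le_refl : reflexive ext_le.
Proof. by move=> A; apply: subsetUl. Qed.

Lemma ext_le_trans : transitive ext_le.
Proof. by move=> B A C AB /sg_idem; apply: subset_trans. Qed.

Lemma ext_le_anti A B : indep M A -> indep M B ->
  ext_le A B -> ext_le B A -> A = B.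
Proof.
move=> iA iB /sg_idem AB /sg_idem BA.
have sgAB : sg A = sg B by apply/eqP; rewrite eqEsubset AB.
by rewrite (base_sg iA) (base_sg iB) sgAB.
Qed.

Definition top_base := [set: E] :\: Act [set: E].

Let gt_top e : gt [set: E] e \subset cl (gt top_base e).
Proof.
have [n] := ubnP #|gt [set: E] e|; elim: n e => // n IHn e len.
apply/subsetP=> x xgt; have ex : (e < x)%O by move: xgt; rewrite !inE.
have sgt : gt [set: E] x \proper gt [set: E] e.
  apply/properP; split.
    by apply/subsetP=> y; rewrite !inE /=; apply: lt_trans.
  by exists x; rewrite !inE /= ?ltxx.
have := IHn x (leq_trans (proper_card sgt) len) => {}IHn.
have sub : cl (gt top_base x) \subset cl (gt top_base e).
  apply: clS; apply/subsetP=> y; rewrite !inE => /andP[-> xy].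
  exact: lt_trans xy.
have [xT|xT] := boolP (x \in top_base).
  by apply: (subsetP (sub_cl _)); rewrite inE xT.
apply: (subsetP sub); apply: (subsetP (cl_trans IHn)).
by move: xT; rewrite -in_Act !inE andbT negbK.
Qed.

Lemma ext_le_top A : ext_le A top_base.
Proof.
apply/subsetP=> e _; rewrite in_sg.
have [//|eT /=] := boolP (e \in top_base).
apply: (subsetP (cl_trans (gt_top e))).
by move: eT; rewrite -in_Act !inE andbT negbK.
Qed.

Lemma top_base_is_base : is_base M top_base.
Proof.
apply/maxsetP; split.
  apply: contraT => dT.
  have [C cC CT] := @minset_exists _ (fun A => ~~ indep M A) _ dT.
  have [C0|[e eC]] := set_0Vmem C.
    by move: (minsetp cC); rewrite C0 indep0.
  pose m := [arg min_(x < e in C) x]%O.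
  have [mC minC] : m \in C /\ forall y, y \in C -> (m <= y)%O.
    by rewrite /m; case: Order.TotalTheory.arg_minP => // x xC xmin; split.
  have : m \in top_base := subsetP CT _ mC.
  rewrite !inE /= andbT => /existsP[]; exists C.
  rewrite /circuit cC mC /=; apply/andP; split.
    by apply/subsetP=> y; rewrite !inE orbT.
  exact/forall_inP.
move=> D iD TD; apply/eqP; rewrite eq_sym eqEsubset TD /=; apply/subsetP=> e eD.
have := subsetP (ext_le_top setT) e (in_setT _); rewrite in_sg => /orP[//|].
move/(subsetP (clS _)) => /(_ (D :\ e)) => /=.
have sub : gt top_base e \subset D :\ e.
  apply/subsetP=> x; rewrite inE => /andP[/(subsetP TD) xD ex].
  by rewrite !inE xD gt_eqF.
case/(_ sub)/in_cl => [|[I [ID _ /negP[]]]]; first by rewrite !inE eqxx.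
by apply: indepS iD; rewrite subUset sub1set eD (subset_trans ID) ?subsetDl.
Qed.

End Activity.

Fact ext_display : Order.disp_t. Proof. exact: Order.Disp tt tt. Qed.

(* [L(M)]: the bases of [M] under the external order, [None] being the
   adjoined minimum. *)
Definition ext_lattice (d : Order.disp_t) (E : finOrderType d)
    (M : matroid E) :=
  option (base M).

Section ExtLattice.
Variables (d : Order.disp_t) (E : finOrderType d) (M : matroid E).
Local Notation L := (ext_lattice M).

Definition ext_lattice_le (x y : L) : bool :=
  match x, y with
  | None, _ => true
  | Some _, None => false
  | Some A, Some B => ext_le M (val A) (val B)
  end.

Lemma ext_lattice_le_refl : reflexive ext_lattice_le.
Proof. by case=> //= A; apply: ext_le_refl. Qed.

Lemma ext_lattice_le_anti : antisymmetric ext_lattice_le.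
Proof.
case=> [[A bA]|] [[B bB]|] //= /andP[AB BA]; congr Some; apply: val_inj => /=.
exact: ext_le_anti (base_indep bA) (base_indep bB) AB BA.
Qed.

Lemma ext_lattice_le_trans : transitive ext_lattice_le.
Proof. by case=> [B|] [A|] [C|] //=; apply: ext_le_trans. Qed.

HB.instance Definition _ := Finite.on L.
HB.instance Definition _ := Order.Le_isPOrder.Build ext_display L
  ext_lattice_le_refl ext_lattice_le_anti ext_lattice_le_trans.

Lemma ext_lattice_le0x (x : L) : ((None : L) <= x)%O.
Proof. by []. Qed.

HB.instance Definition _ :=
  Order.hasBottom.Build ext_display L ext_lattice_le0x.

Definition ext_lattice_top : L :=
  Some (exist _ (top_base M) (top_base_is_base M) : base M).

Lemma ext_lattice_lex1 (x : L) : (x <= ext_lattice_top)%O.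
Proof. by case: x => [A|//]; apply: ext_le_top. Qed.

HB.instance Definition _ := Order.hasTop.Build ext_display L ext_lattice_lex1.

Lemma ext_lattice_maxE (T : base M) :
  (forall x : L, (x <= (Some T : L))%O) -> val T = top_base M.
Proof.
move=> maxT; suff [->] : (Some T : L) = \top%O by [].
by apply/eqP; rewrite eq_le lex1 maxT.
Qed.

End ExtLattice.

(* Faces are nonempty; elements of [V] need not be vertices. *)
Record simplicial_complex (V : finType) := SimplicialComplex {
  faces : {set {set V}};
  faces0 : set0 \notin faces;
  facesS : forall s t : {set V},
    t \subset s -> t != set0 -> s \in faces -> t \in faces
}.

Section OrderComplex.
Variables (d : Order.disp_t) (P : finTBPOrderType d).

Definition proper_part := {x : P | (x != \bot%O) && (x != \top%O)}.

Definition chains : {set {set proper_part}} :=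
  [set C | (C != set0) &&
           [forall x in C, forall y in C, (val x >=< val y)%O]].

Lemma chains0 : set0 \notin chains.
Proof. by rewrite inE eqxx. Qed.

Lemma chainsS (s t : {set proper_part}) :
  t \subset s -> t != set0 -> s \in chains -> t \in chains.
Proof.
rewrite !inE => /subsetP ts -> /andP[_ /forall_inP sC] /=.
apply/forall_inP => x /ts/sC/forall_inP xC.
by apply/forall_inP => y /ts/xC.
Qed.

Definition order_complex : simplicial_complex proper_part :=
  SimplicialComplex chains0 chainsS.

End OrderComplex.

Section IndependenceComplex.
Variables (E : finType) (N : matroid E).

Definition indep_faces := [set S : {set E} | (S != set0) && indep N S].

Lemma indep_faces0 : set0 \notin indep_faces.
Proof. by rewrite inE eqxx. Qed.

Lemma indep_facesS (s t : {set E}) :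
  t \subset s -> t != set0 -> s \in indep_faces -> t \in indep_faces.
Proof. by rewrite !inE => ts -> /andP[_]; apply: indepS. Qed.

Definition indep_complex : simplicial_complex E :=
  SimplicialComplex indep_faces0 indep_facesS.

End IndependenceComplex.

Definition Delta (d : Order.disp_t) (E : finOrderType d) (M : matroid E) :=
  order_complex (ext_lattice M).

Local Open Scope ring_scope.

Section Chains.
Variables (V : finType) (K : simplicial_complex V).

(* A chain is a finitely supported integer function on the faces of [K], the
   empty face being added in degree -1; a face [s] stands for the oriented
   simplex listing [s] in increasing order of [enum_rank].  Since
   [#|s|%:Z == i + 1] fails for [i < -1], there are no chains there. *)
Definition is_chain (i : int) (c : {ffun {set V} -> int}) := [forall s,
  (c s != 0) ==> ((s == set0) || (s \in faces K)) && (#|s|%:Z == i + 1)].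

(* The number of vertices of [s] preceding [v], hence the position of [v]
   in [v |: s] when [v \notin s]. *)
Definition pos (v : V) (s : {set V}) :=
  #|[set u in s | (enum_rank u < enum_rank v)%N]|.

(* The coefficient at [s] collects the faces [v |: s] having [s] as a facet,
   so a face [v_0 < ... < v_k] is sent to the alternating sum, with sign
   [(-1) ^+ j], of its facets omitting [v_j]. *)
Definition bd (c : {ffun {set V} -> int}) : {ffun {set V} -> int} :=
  [ffun s : {set V} => \sum_(v | v \notin s) (-1) ^+ pos v s * c (v |: s)].

Lemma bd_is_zmod_morphism : zmod_morphism bd.
Proof.
move=> b c; apply/ffunP=> s; rewrite !ffunE -sumrB; apply: eq_bigr => v _.
by rewrite !ffunE mulrBr.
Qed.

HB.instance Definition _ :=
  GRing.isZmodMorphism.Build _ _ bd bd_is_zmod_morphism.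

Lemma bd_bd c : bd (bd c) = 0.
Proof.
apply/ffunP=> s; rewrite !ffunE.
pose F v w : int := (-1) ^+ (pos v s + pos w (v |: s)) * c (w |: (v |: s)).
pose P v w := [&& v \notin s, w \notin s & v != w].
transitivity (\sum_v \sum_(w | P v w) F v w).
  rewrite big_mkcond; apply: eq_bigr => v _; case: ifP => [vs|/negbFE vs].
    rewrite ffunE big_distrr /=; apply: eq_big => [w|w _].
      by rewrite /P vs !inE negb_or eq_sym andbC.
    by rewrite /F exprD mulrA.
  by rewrite big1 // => w; rewrite /P vs.
have anti v w : P v w -> F w v = - F v w.
  case/and3P=> vs ws vw; rewrite /F setUCA -mulNr; congr (_ * _).
  have posU x y : x \notin s -> y \notin s -> x != y ->
      pos y (x |: s) = ((enum_rank x < enum_rank y)%N + pos y s)%N.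
    move=> xs ys xy; rewrite /pos; case: ltnP => xlty.
      transitivity #|x |: [set u in s | (enum_rank u < enum_rank y)%N]|.
        congr #|pred_of_set _|; apply/setP=> u; rewrite !inE.
        by case: eqVneq => //= ->; rewrite xlty.
      by rewrite cardsU1 inE (negPf xs).
    rewrite add0n; congr #|pred_of_set _|; apply/setP=> u; rewrite !inE.
    by case: eqVneq => //= ->; rewrite ltnNge xlty (negPf xs).
  rewrite (posU v w) // (posU w v) 1?eq_sym //.
  have : enum_rank v != enum_rank w by rewrite (inj_eq enum_rank_inj).
  rewrite neq_ltn !exprD; case: ltngtP => //= _ _;
    by rewrite !(expr1, expr0); ring.
set S := LHS; suff SN : S = - S.
  have : S *+ 2 = 0 by rewrite mulr2n {1}SN addNr.
  by move/eqP; rewrite mulrn_eq0 => /eqP.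
rewrite {1}/S.
under eq_bigr => v _ do
  under eq_bigr => w Pvw do rewrite -[F v w]opprK -(anti v w Pvw).
rewrite (exchange_big_dep predT) //= /S -sumrN; apply: eq_bigr => w _.
rewrite -sumrN; apply: eq_bigl => v.
by rewrite /P andbCA eq_sym.
Qed.

Lemma is_chain0 i : is_chain i 0.
Proof. by apply/forallP=> s; rewrite ffunE eqxx. Qed.

Lemma is_chainB i b c : is_chain i b -> is_chain i c -> is_chain i (b - c).
Proof.
move=> /forallP bi /forallP ci; apply/forallP=> s; apply/implyP.
rewrite !ffunE => nz; have [b0|/(implyP (bi s))//] := eqVneq (b s) 0.
by apply: (implyP (ci s)); apply: contraNneq nz => c0; rewrite b0 c0 subrr.
Qed.

Lemma is_chain_bd i c : is_chain i c -> is_chain (i - 1) (bd c).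
Proof.
move=> /forallP ci; apply/forallP=> s; apply/implyP; rewrite ffunE subrK => nz.
have [/forall_inP c0|] := boolP [forall v in ~: s, c (v |: s) == 0].
  move: nz; rewrite big1 ?eqxx // => v vs.
  by rewrite (eqP (c0 v _)) ?mulr0 // inE.
case/forall_inPn => v; rewrite inE => vs /(implyP (ci _)).
rewrite cardsU1 vs add1n -addn1 PoszD (can_eq (addrK 1)) => /andP[sK ->].
rewrite andbT; have [//|s0 /=] := eqVneq s set0.
case/orP: sK => [/eqP vs0|]; last by apply: facesS => //; apply: subsetUr.
by move: (in_set0 v); rewrite -vs0 setU11.
Qed.

Definition is_cycle i c := is_chain i c && (bd c == 0).

Lemma is_cycle_zmod_closed i : zmod_closed (is_cycle i).
Proof.
split=> [|b c /andP[bi /eqP b0] /andP[ci /eqP c0]]; apply/andP.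
  by rewrite is_chain0 raddf0.
by rewrite is_chainB //= raddfB /= b0 c0 subr0.
Qed.

HB.instance Definition _ i :=
  GRing.isZmodClosed.Build _ (is_cycle i) (is_cycle_zmod_closed i).

Record cycles i := Cycle { cycle_val : {ffun {set V} -> int};
                           cycleP : cycle_val \in is_cycle i }.

HB.instance Definition _ i := [isSub for @cycle_val i].
HB.instance Definition _ i := [Choice of cycles i by <:].
HB.instance Definition _ i := [SubChoice_isSubZmodule of cycles i by <:].

Definition is_boundary i (z : cycles i) : bool :=
  `[< exists2 b, is_chain (i + 1) b & bd b = val z >].

Lemma is_boundary_zmod_closed i : zmod_closed (@is_boundary i).
Proof.
split=> [|y z /asboolP[b bi by_] /asboolP[c ci cz]]; apply/asboolP.
  by exists 0; [exact: is_chain0|rewrite !raddf0].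
by exists (b - c); [exact: is_chainB|rewrite !raddfB /= by_ cz].
Qed.

HB.instance Definition _ i :=
  GRing.isZmodClosed.Build _ (@is_boundary i) (is_boundary_zmod_closed i).

Definition reduced_homology (i : int) : Type :=
  Quotient.quot (GRing.ZmodClosed.clone _ (@is_boundary i) _).

HB.instance Definition _ i := GRing.Zmodule.on (reduced_homology i).

End Chains.

Definition isomorphic_zmod (A B : zmodType) :=
  exists f : {additive A -> B}, bijective f.

From mathcomp Require Import classical_sets set_interval reals.
From mathcomp Require Import topology normedtype.

Import numFieldNormedType.Exports.
Local Open Scope classical_set_scope.

(* Barycentric coordinates, with the subspace topology of the product topology
   on [V -> R]. *)
Definition realization (R : realType) (V : finType)
    (K : simplicial_complex V) : Type :=
  set_type [set x : prod_topology (fun _ : V => R) |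
    [/\ forall v, 0 <= x v, \sum_v x v = 1 &
        [set v | x v != 0]%SET \in faces K]].

HB.instance Definition _ (R : realType) (V : finType)
    (K : simplicial_complex V) := Topological.on (realization R K).

Definition homotopic (R : realType) (X Y : topologicalType) (f g : X -> Y) :=
  exists H : R * X -> Y,
    [/\ {within `[0, 1] `*` [set: X], continuous H},
        forall x, H (0, x) = f x & forall x, H (1, x) = g x].

Definition homotopy_equivalent (R : realType) (X Y : topologicalType) :=
  exists (f : X -> Y) (g : Y -> X),
    [/\ continuous f, continuous g,
        homotopic R (g \o f) id & homotopic R (f \o g) id].

(* Main.v *)
Require Import Defs.
From HB Require Import structures.
From mathcomp Require Import all_boot all_order all_algebra ring boolp.

(**
  For a base [A] let [F A = T \ A], and for a face [S] of [IN(M^*|T)] let [G S]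
  be the lexicographically maximal base of the deletion of [S].  Elements
  outside [B] that are active with respect to [B] are not in [T], hence [F] is
  order-reversing, and [A <= G S] if and only if [S] is contained in [F A]: a
  Galois connection between the proper part of [L(M)] and the face poset of
  [IN(M^*|T)].

  Homology is compared by the method of acyclic carriers, all carriers being
  cones.  For the homotopy equivalence, a vertex [A] is sent to the barycenter
  of [F A], and a point of [IN(M^*|T)] to a combination of the vertices [G S],
  [S] ranging over its superlevel sets; the two composites are joined to the
  identities by explicit homotopies.
*)

Set Implicit Arguments.
Unset Strict Implicit.
Unset Printing Implicit Defensive.

Import Order.TTheory GRing.Theory Num.Theory.
Local Open Scope ring_scope.

(** * Cones and acyclic carriers *)

Section Cone.
Variable V : finType.
Implicit Types (s t : {set V}) (v a : V) (c : {ffun {set V} -> int}).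

Lemma pos_setU1 v a s : v \notin s ->
  pos a (v |: s) = ((enum_rank v < enum_rank a) + pos a s)%N.
Proof.
move=> vs; rewrite /pos; case: ltnP => va.
  transitivity #|v |: [set u in s | (enum_rank u < enum_rank a)%N]|.
    congr #|pred_of_set _|; apply/setP=> u; rewrite !inE.
    by case: eqVneq => //= ->; rewrite va.
  by rewrite cardsU1 inE (negPf vs).
rewrite add0n; congr #|pred_of_set _|; apply/setP=> u; rewrite !inE.
by case: eqVneq => //= ->; rewrite ltnNge va (negPf vs).
Qed.

(** The join of a chain with the apex [a]. The sign puts [a] at its place in the increasing order of
    vertices, and faces of [c] that already contain [a] contribute nothing. *)
Definition cone a c : {ffun {set V} -> int} :=
  [ffun s : {set V} => if a \in s then (-1) ^+ pos a s * c (s :\ a) else 0].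

(** [cone a] contracts the augmented complex of all subsets, so every cycle bounds its own cone.
    Away from [a] only the term [v = a] survives; on [a |: t] inserting [a] and [v] in the two
    possible orders gives opposite signs. *)
Lemma bd_cone a c : bd (cone a c) = c - cone a (bd c).
Proof.
apply/ffunP=> s; rewrite !ffunE; have [as_|as_] := boolP (a \in s); last first.
  rewrite (bigD1 a) //= ffunE setU11 setU1K // pos_setU1 // ltnn add0n.
  rewrite mulrA -expr2 sqrr_sign mul1r subr0 big1 ?addr0 // => v /andP[vs va].
  by rewrite ffunE !inE eq_sym (negPf va) (negPf as_) mulr0.
have [t at_ ->] : exists2 t : {set V}, a \notin t & s = a |: t.
  by exists (s :\ a); rewrite ?setD11 ?setD1K.
rewrite setU1K // [X in _ - _ * X](bigD1 a) //=.
rewrite pos_setU1 // ltnn add0n mulrDr mulrA -expr2 sqrr_sign mul1r opprD.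
rewrite addNKr.
rewrite mulr_sumr -sumrN; apply: eq_big => [v|v].
  by rewrite !inE negb_or andbC.
rewrite !inE negb_or => /andP[va vt].
rewrite ffunE !inE eqxx orbT setUCA setU1K; last first.
  by rewrite !inE eq_sym (negPf va).
have avt : a \notin v |: t by rewrite !inE negb_or eq_sym va.
rewrite (pos_setU1 v at_) (pos_setU1 a avt) (pos_setU1 a vt) ltnn add0n.
have : enum_rank v != enum_rank a by rewrite (inj_eq enum_rank_inj).
rewrite neq_ltn !exprD; case: ltngtP => //= _ _;
  by rewrite !(expr1, expr0); ring.
Qed.

End Cone.

Section FamilyExtension.
Variables V W : finType.
Implicit Types (s : {set V}) (t : {set W}) (v : V).
Implicit Types (x : {set V} -> {ffun {set W} -> int}).
Implicit Types (c : {ffun {set V} -> int}).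

Definition lin x c := \sum_s x s *~ c s.

Lemma lin_is_zmod_morphism x : zmod_morphism (lin x).
Proof.
move=> b c; rewrite /lin -sumrB; apply: eq_bigr => s _.
by rewrite !ffunE mulrzBr.
Qed.

HB.instance Definition _ x :=
  GRing.isZmodMorphism.Build _ _ (lin x) (lin_is_zmod_morphism x).

Lemma linE x c t : lin x c t = \sum_s x s t * c s.
Proof.
rewrite sum_ffunE; apply: eq_bigr => s _.
by rewrite ffunMzE mulrzz.
Qed.

(** This is [lin x] applied to the boundary of the simplex [s]; hence [bd (x s) = dfam x s] is the
    chain map equation on generators. *)
Definition dfam x s := \sum_(v in s) x (s :\ v) *~ (-1) ^+ pos v s.

Lemma lin_bd x c : lin x (bd c) = lin (dfam x) c.
Proof.
transitivity (\sum_v \sum_(s : {set V} | v \notin s)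
   x s *~ ((-1) ^+ pos v s * c (v |: s))).
  rewrite (exchange_big_dep predT) //=; apply: eq_bigr => s _.
  by rewrite ffunE mulrz_sumr.
transitivity (\sum_v \sum_(s : {set V} | v \in s)
   x (s :\ v) *~ ((-1) ^+ pos v s * c s)); last first.
  rewrite (exchange_big_dep predT) //=; apply: eq_bigr => s _.
  by rewrite mulrz_suml; apply: eq_bigr => v _; rewrite mulrzA.
apply: eq_bigr => v _.
(* Adding [v] matches the facets missing [v] with the simplices containing it, and [v] does not
   count in its own position. *)
rewrite [RHS](reindex_onto (fun s => v |: s) (fun s => s :\ v)) /=; last first.
  by move=> s vs; rewrite setD1K.
apply: eq_big => [s|s vs]; last by rewrite setU1K // pos_setU1 // ltnn add0n.
rewrite setU11 /=; apply/idP/eqP => [/setU1K //|<-]; by rewrite setD11.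
Qed.

Definition delta s : {ffun {set V} -> int} := [ffun t => (t == s)%:R].

Lemma lin_delta x s : lin x (delta s) = x s.
Proof.
rewrite /lin (bigD1 s) //= big1 => [|t /negPf ts].
  by rewrite ffunE eqxx addr0.
by rewrite ffunE ts.
Qed.

Lemma dfamK x s : dfam (dfam x) s = 0.
Proof. by rewrite -lin_delta -lin_bd -lin_bd bd_bd raddf0. Qed.

Lemma bd_lin x c : bd (lin x c) = lin (fun s => bd (x s)) c.
Proof. by rewrite raddf_sum; apply: eq_bigr => s _; rewrite raddfMz. Qed.

Lemma eq_lin x y c : (forall s, c s != 0 -> x s = y s) -> lin x c = lin y c.
Proof.
move=> xy; apply: eq_bigr => s _; have [->|/xy-> //] := eqVneq (c s) 0.
by rewrite !mulr0z.
Qed.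

Lemma dfamD x y s : dfam (fun s => x s + y s) s = dfam x s + dfam y s.
Proof. by rewrite -big_split; apply: eq_bigr => v _; rewrite mulrzDl. Qed.

Lemma dfamMz x k s : dfam (fun s => x s *~ k) s = dfam x s *~ k.
Proof. by rewrite [RHS]mulrz_suml; apply: eq_bigr => v _; rewrite mulrzAC. Qed.

Lemma bd_dfam x s : bd (dfam x s) = dfam (fun s => bd (x s)) s.
Proof. by rewrite raddf_sum; apply: eq_bigr => v _; rewrite raddfMz. Qed.

Lemma eq_dfam x y s : (forall v, v \in s -> x (s :\ v) = y (s :\ v)) ->
  dfam x s = dfam y s.
Proof. by move=> xy; apply: eq_bigr => v /xy ->. Qed.

Lemma dfam_supp x s t : dfam x s t != 0 ->
  exists2 v, v \in s & x (s :\ v) t != 0.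
Proof.
rewrite sum_ffunE => nz; apply: contrapT => no; case/negP: nz.
rewrite big1 // => v vs; rewrite ffunMzE.
have [->|nz] := eqVneq (x (s :\ v) t) 0; first by rewrite mul0rz.
by case: no; exists v.
Qed.

Lemma lin_supp x c t : lin x c t != 0 -> exists2 s, c s != 0 & x s t != 0.
Proof.
rewrite linE => nz; apply: contrapT => no; case/negP: nz.
rewrite big1 // => s _; have [->|c0] := eqVneq (c s) 0; first by rewrite mulr0.
have [->|nz] := eqVneq (x s t) 0; first by rewrite mul0r.
by case: no; exists s.
Qed.

End FamilyExtension.

Section IdentityFamily.
Variable V : finType.

Lemma deltaE (c : {ffun {set V} -> int}) : lin (@delta V) c = c.
Proof.
apply/ffunP=> t; rewrite linE (bigD1 t) //= big1 => [|s /negPf st].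
  by rewrite ffunE eqxx mul1r addr0.
by rewrite ffunE eq_sym st mul0r.
Qed.

Lemma bd_delta (s : {set V}) : bd (delta s) = dfam (@delta V) s.
Proof. by rewrite -[LHS]deltaE lin_bd lin_delta. Qed.

End IdentityFamily.

Section Carrier.
Variables (V W : finType) (K : simplicial_complex V).
Implicit Types (s : {set V}) (t : {set W}) (w : W).
Implicit Types (x y z : {set V} -> {ffun {set W} -> int}).

Definition aface s := (s == set0) || (s \in faces K).

Lemma afaceS s s' : s' \subset s -> aface s -> aface s'.
Proof.
rewrite /aface; have [//|s'0 /=] := eqVneq s' set0.
move=> s's /orP[/eqP s0|]; last exact: facesS.
by move: s's s'0; rewrite s0 subset0 => ->.
Qed.

(* [cr s t]: the face [t] (possibly empty) belongs to the carrier of [s];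
   every carrier of a nonempty face is a cone. *)
Variables (cr : {set V} -> {set W} -> bool).
Hypothesis crS : forall s s' t, aface s -> s' \subset s -> cr s' t -> cr s t.
Hypothesis cr_cone : forall s, s \in faces K ->
  exists w, forall t, cr s t -> cr s (w |: t).

Definition carried k x := forall s t, aface s -> x s t != 0 ->
  cr s t /\ #|t| = (#|s| + k)%N.

Definition apex s := [pick w | [forall t, cr s t ==> cr s (w |: t)]].

(** The value 0 is a default: at faces of [K] an apex exists by [cr_cone]. *)
Definition cone_apex s (c : {ffun {set W} -> int}) :=
  if apex s is Some w then cone w c else 0.

Lemma bd_cone_apex s (c : {ffun {set W} -> int}) :
  s \in faces K -> bd c = 0 -> bd (cone_apex s c) = c.
Proof.
move=> sK c0; rewrite /cone_apex /apex; case: pickP => [w _|no].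
  rewrite bd_cone c0; apply/ffunP=> t; rewrite !ffunE.
  by case: ifP; rewrite ?mulr0 subr0.
have [w wP] := cr_cone sK; have /negP[] := no w.
by apply/forallP=> t; apply/implyP; apply: wP.
Qed.

Lemma cone_apex_supp s (c : {ffun {set W} -> int}) k :
  (forall t, c t != 0 -> cr s t /\ #|t| = k) ->
  forall t, cone_apex s c t != 0 -> cr s t /\ #|t| = k.+1.
Proof.
move=> ck t; rewrite /cone_apex /apex; case: pickP => [w /forallP wP|no].
  rewrite ffunE; case: ifP => [wt|]; last by rewrite eqxx.
  rewrite mulf_eq0 negb_or => /andP[_ /ck[crt ct]]; split.
    by rewrite -(setD1K wt); apply: (implyP (wP _)).
  by rewrite (cardsD1 w t) wt ct.
by rewrite ffunE eqxx.
Qed.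

(** The counter [n] stands for [#|s|] and makes the recursion structural. Each value fills the
    prescribed cycle by coning it inside the carrier of [s]. *)
Fixpoint extend_rec (x0 : {ffun {set W} -> int}) y (eps : int) n s :=
  if n is n'.+1 then
    cone_apex s (y s + dfam (extend_rec x0 y eps n') s *~ eps)
  else x0.

(* Acyclic carriers: [eps = 1], [y = 0] yields chain maps, and [eps = -1],
   [y] a difference of two chain maps, yields chain homotopies. *)
Lemma carrier_extend (x0 : {ffun {set W} -> int}) y eps k :
    bd x0 = y set0 ->
    (forall t, x0 t != 0 -> cr set0 t /\ #|t| = k) ->
    (forall s, aface s -> bd (y s) + dfam y s *~ eps = 0) ->
    (forall s t, s \in faces K -> y s t != 0 ->
       cr s t /\ #|t|.+1 = (#|s| + k)%N) ->
  exists x, [/\ x set0 = x0, carried k x &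
    forall s, aface s -> bd (x s) = y s + dfam x s *~ eps].
Proof.
move=> bdx0 x0k bdy yk; pose x s := extend_rec x0 y eps #|s| s.
have xE s : s != set0 ->
    x s = cone_apex s (y s + dfam x s *~ eps).
  rewrite -card_gt0 {1}/x; case En: #|s| => [//|n] _ /=.
  rewrite (@eq_dfam _ _ _ x) // => v vs; rewrite /x.
  by move: En; rewrite (cardsD1 v s) vs add1n => -[->].
have x_0 : x set0 = x0 by rewrite /x cards0.
exists x; split=> //.
  move=> s; have [n] := ubnP #|s|; elim: n s => // n IHn s ltn t sK.
  have [->|s0] := eqVneq s set0; first by rewrite x_0 cards0; apply: x0k.
  have {}sK : s \in faces K by move: sK; rewrite /aface (negPf s0).
  have [k' ek] : exists k', (#|s| + k = k'.+1)%N.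
    by exists (#|s| + k).-1; rewrite prednK // addn_gt0 card_gt0 s0.
  rewrite xE // ek; apply: cone_apex_supp => {}t.
  rewrite ffunE ffunMzE.
  have [->|/(yk _ _ sK)[? /eqP]] := eqVneq (y s t) 0; last first.
    by rewrite ek eqSS => /eqP.
  have [->|] := eqVneq (dfam x s t) 0.
    by rewrite mul0rz addr0 eqxx.
  case/dfam_supp => v vs /IHn[].
  - by rewrite -ltnS (leq_trans _ ltn) // ltnS [X in (_ < X)%N](cardsD1 v) vs.
  - by apply: (afaceS (subsetDl _ _)); rewrite /aface sK orbT.
  - move=> crt ct _; split.
      by apply: crS crt; rewrite ?subsetDl // /aface sK orbT.
    by move: ek; rewrite (cardsD1 v) vs ct add1n addSn => -[].
move=> s; have [n] := ubnP #|s|; elim: n s => // n IHn s ltn sK.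
have [->|s0] := eqVneq s set0.
  by rewrite x_0 bdx0 /dfam big_set0 mul0rz addr0.
rewrite {1}xE // bd_cone_apex //; first by move: sK; rewrite /aface (negPf s0).
(* The chain that was coned is a cycle: by induction its boundary is [bd (y s) + dfam y s *~ eps]
   plus a multiple of [dfam (dfam x) s], and both vanish. *)
rewrite raddfD raddfMz /= bd_dfam.
rewrite (@eq_dfam _ _ _ (fun s => y s + dfam x s *~ eps)); last first.
  move=> v vs; apply: IHn; last exact: afaceS (subsetDl _ _) sK.
  by rewrite -ltnS (leq_trans _ ltn) // ltnS [X in (_ < X)%N](cardsD1 v) vs.
by rewrite dfamD dfamMz dfamK mul0rz addr0 bdy.
Qed.

End Carrier.

Lemma is_chainP (V : finType) (K : simplicial_complex V) i
    (c : {ffun {set V} -> int}) :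
  reflect (forall s, c s != 0 -> aface K s /\ #|s|%:Z = i + 1) (is_chain K i c).
Proof.
apply: (iffP forallP) => [ci s /(implyP (ci s))/andP[? /eqP]|ci s] //.
by apply/implyP=> /ci[sK ->]; rewrite eqxx andbT.
Qed.

Section ChainMaps.
Variables (V W : finType) (K : simplicial_complex V) (L : simplicial_complex W).
Implicit Types (s : {set V}) (t : {set W}).
Implicit Types (x y z : {set V} -> {ffun {set W} -> int}).

Definition acyclic_carrier (cr : {set V} -> {set W} -> bool) :=
  [/\ cr set0 set0,
      forall s t, aface K s -> cr s t -> aface L t,
      forall s s' t, aface K s -> s' \subset s -> cr s' t -> cr s t &
      forall s, s \in faces K -> exists w, forall t, cr s t -> cr s (w |: t)].

(** Fixing the value at the empty face, the generator in degree -1, makes these chain maps preserve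
    the augmentation. *)
Definition carried_map cr x :=
  [/\ x set0 = delta set0, carried K cr 0 x &
      forall s, aface K s -> bd (x s) = dfam x s].

Lemma carried_map_exists cr : acyclic_carrier cr -> exists x, carried_map cr x.
Proof.
case=> cr0 crL crS crC.
have [] := carrier_extend (x0 := delta set0) (y := fun=> 0) (eps := 1) (k := 0)
  crS crC.
- by rewrite bd_delta /dfam big_set0.
- move=> t; rewrite ffunE.
  by have [->|] := eqVneq t set0; rewrite ?eqxx ?cards0.
- move=> s _; rewrite raddf0 add0r mulr1z; apply: big1 => v _.
  by rewrite mul0rz.
- by move=> s t _; rewrite ffunE eqxx.
by move=> x [x0 xc bdx]; exists x; split=> // s /bdx; rewrite add0r mulr1z.
Qed.

Lemma carried_map_homotopic cr x y :
  acyclic_carrier cr -> carried_map cr x -> carried_map cr y ->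
  exists2 D, carried K cr 1 D &
    forall s, aface K s -> bd (D s) = x s - y s - dfam D s.
Proof.
case=> cr0 crL crS crC [x0 xc bdx] [y0 yc bdy].
have [] := carrier_extend (x0 := 0) (y := fun s => x s + y s *~ (-1))
  (eps := -1) (k := 1) crS crC.
- by rewrite raddf0 x0 y0 mulrN1z subrr.
- by move=> t; rewrite ffunE eqxx.
- move=> s sK; rewrite raddfD raddfMz /= dfamD dfamMz bdx // bdy //.
  by rewrite [X in _ + X]mulrN1z subrr.
- move=> s t sK; rewrite !mulrN1z !ffunE.
  have {}sK : aface K s by rewrite /aface sK orbT.
  have [->|/(xc s t sK)[? ->]] := eqVneq (x s t) 0; last by rewrite addn0 addn1.
  by rewrite add0r oppr_eq0 => /(yc s t sK)[? ->]; rewrite addn0 addn1.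
by move=> D [_ Dc bdD]; exists D => // s /bdD; rewrite !mulrN1z.
Qed.

Lemma is_chain_lin (cr : {set V} -> {set W} -> bool) k x i c :
  (forall s t, aface K s -> cr s t -> aface L t) -> carried K cr k x ->
  is_chain K i c -> is_chain L (i + k%:Z) (lin x c).
Proof.
move=> crL xc /is_chainP ci; apply/is_chainP=> t /lin_supp[s /ci[sK cs]].
move=> /(xc _ _ sK)[/(crL _ _ sK) tL ->]; split=> //.
by rewrite PoszD cs addrAC.
Qed.

Lemma bd_carried_map cr x i c : carried_map cr x -> is_chain K i c ->
  bd (lin x c) = lin x (bd c).
Proof.
case=> _ _ bdx /is_chainP ci; rewrite bd_lin lin_bd.
by apply: eq_lin => s /ci[/bdx].
Qed.

End ChainMaps.

(** * Maps induced on reduced homology *)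

Section Homology.

Lemma carried_map_comp (U V W : finType) (K : simplicial_complex U)
    (L : simplicial_complex V) cr1 cr2 (cr : {set U} -> {set W} -> bool) x y :
  acyclic_carrier K L cr1 -> carried_map K cr1 x -> carried_map L cr2 y ->
  (forall s t r, aface K s -> cr1 s t -> cr2 t r -> cr s r) ->
  carried_map K cr (fun s => lin y (x s)).
Proof.
move=> [_ crL _ _] [x0 xc bdx] [y0 yc bdy] crc; split=> [|s r sK|s sK].
- by rewrite x0 lin_delta.
- case/lin_supp=> t /(xc _ _ sK)[crt ct] /(yc _ _ (crL _ _ sK crt))[crr cr_].
  by split; [apply: crc crr | rewrite cr_ ct addn0].
have -> : bd (lin y (x s)) = lin y (bd (x s)).
  rewrite bd_lin lin_bd; apply: eq_lin => t /(xc _ _ sK)[crt _].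
  by apply: bdy; apply: crL crt.
rewrite bdx // /dfam [LHS](raddf_sum (lin y)).
by apply: eq_bigr => v _; rewrite /= raddfMz.
Qed.

Lemma carried_map_id (V : finType) (K : simplicial_complex V)
    (cr : {set V} -> {set V} -> bool) :
  (forall s, aface K s -> cr s s) -> carried_map K cr (@delta V).
Proof.
move=> crr; split=> // [s t sK|s _]; last exact: bd_delta.
rewrite ffunE; have [-> _|] := eqVneq t s; last by rewrite eqxx.
by rewrite addn0; split=> //; apply: crr.
Qed.

Lemma lin_comp (U V W : finType) (y : {set V} -> {ffun {set W} -> int})
  (x : {set U} -> {ffun {set V} -> int}) c :
  lin y (lin x c) = lin (fun s => lin y (x s)) c.
Proof.
rewrite [lin x c]/lin [LHS](raddf_sum (lin y)).
by apply: eq_bigr => s _; rewrite /= raddfMz.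
Qed.

(** For a chain homotopy [D] between the two maps, the term [dfam D] contributes [lin D (bd z) = 0]
    on a cycle, so [lin D z] bounds the difference. *)
Lemma carried_map_cycle_homotopic (V W : finType) (K : simplicial_complex V)
    (L : simplicial_complex W) cr x y i z :
  acyclic_carrier K L cr -> carried_map K cr x -> carried_map K cr y ->
  z \in is_cycle K i ->
  exists2 b, is_chain L (i + 1) b & bd b = lin x z - lin y z.
Proof.
move=> crA xc yc /andP[zi /eqP bdz]; have crL := let: And4 _ h _ _ := crA in h.
have [D Dc bdD] := carried_map_homotopic crA xc yc.
exists (lin D z); first exact: is_chain_lin Dc zi.
have linB u : lin (fun s => x s - y s - u s) z = lin x z - lin y z - lin u z.
  rewrite /lin -!sumrB; apply: eq_bigr => s _; by rewrite !mulrzBl.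
rewrite bd_lin; transitivity (lin (fun s => x s - y s - dfam D s) z).
  by apply: eq_lin => s; move/is_chainP: zi => zi /zi[/bdD].
by rewrite linB -lin_bd bdz raddf0 subr0.
Qed.

Section HomologyClass.
Variables (V : finType) (K : simplicial_complex V) (i : int).
Local Notation boundaries := (GRing.ZmodClosed.clone _ (@is_boundary V K i) _).
Local Notation quot := (Quotient.quot boundaries).

Definition homology_class (z : cycles K i) : reduced_homology K i :=
  \pi_quot%qT z.

Definition homology_repr (q : reduced_homology K i) : cycles K i :=
  repr (q : quot).

Lemma homology_reprK q : homology_class (homology_repr q) = q.
Proof. exact: reprK. Qed.

Lemma homology_classB : {morph homology_class : y z / y - z}.
Proof. by move=> y z; rewrite /homology_class !raddfB. Qed.

Lemma homology_classP (y z : cycles K i) :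
  reflect (exists2 b, is_chain K (i + 1) b & bd b = val y - val z)
    (homology_class y == homology_class z).
Proof.
rewrite /homology_class -Quotient.idealrBE.
by apply: (iffP (asboolP _)); rewrite raddfB.
Qed.
End HomologyClass.

Section HomologyMap.
Variables (V W : finType) (K : simplicial_complex V) (L : simplicial_complex W).

Definition preserves_cycles i
    (f : {ffun {set V} -> int} -> {ffun {set W} -> int}) :=
  forall z, z \in is_cycle K i -> f z \in is_cycle L i.

Definition push i f (hf : preserves_cycles i f) (z : cycles K i) : cycles L i :=
  Cycle (hf _ (valP z)).

(** The map acts on a chosen representative; for carried chain maps the choice does not matter, by
    [hom_pi] in [acyclic_carriers_homology_iso]. *)
Definition homology_map i f (hf : preserves_cycles i f)
    (q : reduced_homology K i) : reduced_homology L i :=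
  homology_class (push hf (homology_repr q)).
End HomologyMap.

(** Carriers yield chain maps in both directions; each composite shares an acyclic carrier with the
    identity, hence is chain homotopic to it and induces the identity on homology. *)
Lemma acyclic_carriers_homology_iso (V W : finType)
    (K : simplicial_complex V) (L : simplicial_complex W)
    crKL crLK crKK crLL i :
  acyclic_carrier K L crKL -> acyclic_carrier L K crLK ->
  acyclic_carrier K K crKK -> acyclic_carrier L L crLL ->
  (forall s, aface K s -> crKK s s) -> (forall t, aface L t -> crLL t t) ->
  (forall s t r, aface K s -> crKL s t -> crLK t r -> crKK s r) ->
  (forall s t r, aface L s -> crLK s t -> crKL t r -> crLL s r) ->
  isomorphic_zmod (reduced_homology K i) (reduced_homology L i).
Proof.
move=> aKL aLK aKK aLL idK idL cKK cLL.
have [x xc] := carried_map_exists aKL; have [y yc] := carried_map_exists aLK.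
have cyc (V1 W1 : finType) (K1 : simplicial_complex V1)
    (L1 : simplicial_complex W1) cr u : acyclic_carrier K1 L1 cr ->
    carried_map K1 cr u -> preserves_cycles K1 L1 i (lin u).
  move=> [_ crL _ _] uc z /andP[zi /eqP bdz]; have [_ uc' _] := uc; apply/andP.
  rewrite (bd_carried_map uc zi) bdz raddf0 eqxx.
  by move: (is_chain_lin crL uc' zi); rewrite addr0.
have hx := cyc _ _ _ _ _ _ aKL xc; have hy := cyc _ _ _ _ _ _ aLK yc.
have hom_pi (V1 W1 : finType) (K1 : simplicial_complex V1)
    (L1 : simplicial_complex W1) cr u (hu : preserves_cycles K1 L1 i (lin u)) :
    acyclic_carrier K1 L1 cr -> carried_map K1 cr u -> forall z,
    homology_map hu (homology_class z) = homology_class (push hu z).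
  move=> [_ crL _ _] uc z; have [_ uc' _] := uc.
  apply/eqP/homology_classP => /=.
  have /eqP/homology_classP[b bi bdb] := homology_reprK (homology_class z).
  exists (lin u b).
    by move: (is_chain_lin crL uc' bi); rewrite addr0.
  by rewrite (bd_carried_map uc bi) bdb raddfB.
have xpi := hom_pi _ _ _ _ _ _ hx aKL xc.
have ypi := hom_pi _ _ _ _ _ _ hy aLK yc.
have homB : zmod_morphism (homology_map hx).
  move=> p q; rewrite -[p]homology_reprK -[q]homology_reprK.
  rewrite -homology_classB !xpi -homology_classB; congr homology_class.
  by apply: val_inj; rewrite /= !raddfB.
pose F := GRing.isZmodMorphism.Build _ _ (homology_map hx) homB.
pose f : {additive reduced_homology K i -> reduced_homology L i} :=
  HB.pack (homology_map hx) F.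
exists f; exists (homology_map hy) => /= p.
  rewrite -[p]homology_reprK xpi ypi; apply/eqP/homology_classP => /=.
  rewrite lin_comp -[X in _ - X]deltaE.
  apply: (carried_map_cycle_homotopic aKK) (valP _).
    exact: carried_map_comp aKL xc yc cKK.
  exact: carried_map_id idK.
rewrite -[p]homology_reprK ypi xpi; apply/eqP/homology_classP => /=.
rewrite lin_comp -[X in _ - X]deltaE.
apply: (carried_map_cycle_homotopic aLL) (valP _).
  exact: carried_map_comp aLK yc xc cLL.
exact: carried_map_id idL.
Qed.

End Homology.

(** * A Galois connection between an order complex and a complex *)

Section Galois.
Variables (d : Order.disp_t) (L : finTBPOrderType d).
Variables (W : finType) (K : simplicial_complex W).
Local Notation P := (proper_part L).
Implicit Types (x y : P) (C D : {set P}) (S : {set W}).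

Lemma aface_orderP C :
  reflect (forall x y, x \in C -> y \in C -> (val x >=< val y)%O)
    (aface (order_complex L) C).
Proof.
rewrite /aface inE; apply: (iffP orP) => [[/eqP->|/andP[_ /forall_inP h]]|h].
- by move=> x y; rewrite inE.
- by move=> x y /h/forall_inP/[apply].
- have [|C0] := eqVneq C set0; [by left|right; apply/forall_inP => x xC].
  by apply/forall_inP => y; apply: h.
Qed.

Lemma order_complex_faces C :
  (C \in faces (order_complex L)) = (C != set0) && aface (order_complex L) C.
Proof.
by rewrite /aface; have [->|] := eqVneq C set0; rewrite ?(negPf (faces0 _)).
Qed.

(** An element with the fewest elements of [C] below it is minimal, and in a chain minimal means
    least. *)
Lemma chain_min C : C \in faces (order_complex L) ->
  exists2 m, m \in C & forall x, x \in C -> (val m <= val x)%O.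
Proof.
rewrite order_complex_faces => /andP[/set0Pn[x0 x0C] /aface_orderP Cch].
pose below x := #|[set y in C | (val y <= val x)%O]|.
have [m /= mC minm] := arg_minnP below x0C.
exists m => // x xC; have := Cch _ _ mC xC; rewrite /Order.comparable.
case: (boolP (val m <= val x)%O) => //= nmx xm.
have := minm x xC; rewrite leqNgt => /negP[]; apply: proper_card.
apply/properP; split.
  apply/subsetP => y; rewrite !inE => /andP[-> /=] yx; exact: le_trans yx xm.
by exists m; rewrite !inE ?lexx ?(negPf nmx) ?andbF // andbT.
Qed.

Variables (F : L -> {set W}) (G : {set W} -> L).

(** An antitone Galois connection between the proper part of [L] and the face poset of [K], for
    total functions [F] and [G] that are constrained only on proper elements and faces. *)
Definition galois_faces :=
  [/\ forall x, F (val x) \in faces K,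
      forall S, S \in faces K -> (G S != \bot%O) && (G S != \top%O) &
      forall x S, S \in faces K -> (val x <= G S)%O = (S \subset F (val x))].

Hypothesis FG : galois_faces.

Let faceF x : F (val x) \in faces K. Proof. by case: FG. Qed.

Let properG S : S \in faces K -> (G S != \bot%O) && (G S != \top%O).
Proof. by case: FG => _ h _; apply: h. Qed.

Let galois x S : S \in faces K -> (val x <= G S)%O = (S \subset F (val x)).
Proof. by case: FG => _ _; apply. Qed.

Definition properG_elt S (SK : S \in faces K) : P := exist _ (G S) (properG SK).

Lemma sub_FG S : S \in faces K -> S \subset F (G S).
Proof. by move=> SK; rewrite -(galois (properG_elt SK)) //=. Qed.

Lemma face_FG S : S \in faces K -> F (G S) \in faces K.
Proof. by move=> SK; apply: (faceF (properG_elt SK)). Qed.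

Lemma le_GF x : (val x <= G (F (val x)))%O.
Proof. by rewrite galois. Qed.

Lemma F_anti x y : (val x <= val y)%O -> F (val y) \subset F (val x).
Proof. by move=> xy; rewrite -galois // (le_trans xy (le_GF y)). Qed.

Lemma G_anti S S' : S \in faces K -> S' \in faces K -> S \subset S' ->
  (G S' <= G S)%O.
Proof.
move=> SK S'K SS'; have := galois (properG_elt S'K) SK => /= ->.
exact: subset_trans SS' (sub_FG S'K).
Qed.

Lemma FG_mono S S' : S \in faces K -> S' \in faces K -> S \subset S' ->
  F (G S) \subset F (G S').
Proof.
move=> SK S'K /(G_anti SK S'K).
exact: (@F_anti (properG_elt _) (properG_elt _)).
Qed.

Let face_neq0 S : S \in faces K -> S != set0.
Proof. by apply: contraTneq => ->; apply: faces0. Qed.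

Let aface_neq0 S : aface K S -> S != set0 -> S \in faces K.
Proof. by case/orP=> [/eqP->|//]; rewrite eqxx. Qed.

(* The carrier of a chain is the simplex on the image by [F] of its minimum;
   that of a face [S] consists of the chains above [G S].  The composites are
   carried by the chains above the minimum of a chain, resp. by the simplex
   on [F (G S)]. *)
Definition cr_chain_face C S :=
  (S == set0) || [exists x in C, S \subset F (val x)].

Definition cr_face_chain S C :=
  aface (order_complex L) C &&
  [forall x in C, (S != set0) && (G S <= val x)%O].

Definition cr_chain_chain C D :=
  aface (order_complex L) D &&
  [forall y in D, [exists x in C, (val x <= val y)%O]].

Definition cr_face_face S S' :=
  (S' == set0) || (S != set0) && (S' \subset F (G S)).

Lemma aface0 (V : finType) (N : simplicial_complex V) : aface N set0.
Proof. by rewrite /aface eqxx. Qed.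

Lemma aface_sub (V : finType) (N : simplicial_complex V) (s t : {set V}) :
  t \in faces N -> s \subset t -> aface N s.
Proof. by move=> tN st; apply: (afaceS st); rewrite /aface tN orbT. Qed.

Lemma aface_setU1 x C : aface (order_complex L) C ->
  (forall y, y \in C -> (val x <= val y)%O) -> aface (order_complex L) (x |: C).
Proof.
move=> /aface_orderP Cch xC; apply/aface_orderP=> y z.
rewrite !inE /Order.comparable.
case/predU1P=> [->|yC] /predU1P[->|zC]; rewrite ?lexx //.
- by rewrite (xC z).
- by rewrite (xC y) ?orbT.
- exact: Cch.
Qed.

Lemma acyclic_chain_face : acyclic_carrier (order_complex L) K cr_chain_face.
Proof.
split=> [|C S _ /orP[/eqP->|/exists_inP[x _ SF]]|C C' S _ C'C|C CK].
- by rewrite /cr_chain_face eqxx.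
- exact: aface0.
- exact: aface_sub SF.
- case/orP=> [S0|/exists_inP[x xC' SF]]; apply/orP; [by left|right].
  by apply/exists_inP; exists x => //; apply: (subsetP C'C).
(* As [F] is antitone, every [F (val x)] with [x] in [C] lies in [F (val m)], so any vertex of the
   latter is an apex. *)
- have [m mC minm] := chain_min CK; have /set0Pn[w wF] := face_neq0 (faceF m).
  exists w => S CS; apply/orP; right; apply/exists_inP; exists m => //.
  rewrite subUset sub1set wF /=; case/orP: CS => [/eqP->|].
    exact: sub0set.
  by case/exists_inP=> x /minm/F_anti mx Sx; apply: subset_trans mx.
Qed.

Lemma acyclic_face_chain : acyclic_carrier K (order_complex L) cr_face_chain.
Proof.
split=> [|S C _ /andP[]//|S S' C SK S'S|S SK].
- by rewrite /cr_face_chain aface0; apply/forall_inP=> x; rewrite inE.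
- case/andP=> Cch /forall_inP S'C; apply/andP; split=> //.
  apply/forall_inP=> x /S'C/andP[S'0 GS'x].
  have S0 : S != set0 by apply: contraNneq S'0 => S0; rewrite -subset0 -S0.
  rewrite S0 /=; apply: le_trans GS'x; apply: G_anti => //.
    exact: aface_neq0 (afaceS S'S SK) S'0.
  exact: aface_neq0.
(* [G S] lies below all members of a chain in the carrier, so adding it leaves a chain. *)
- exists (properG_elt SK) => C /andP[Cch /forall_inP SC]; apply/andP; split.
    by apply: aface_setU1 => // y /SC/andP[].
  apply/forall_inP=> x; rewrite !inE => /predU1P[->|/SC//].
  by rewrite face_neq0 /=.
Qed.

Lemma acyclic_chain_chain :
  acyclic_carrier (order_complex L) (order_complex L) cr_chain_chain.
Proof.
split=> [|C D _ /andP[]//|C C' D _ C'C /andP[Dch /forall_inP C'D]|C CK].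
- by rewrite /cr_chain_chain aface0; apply/forall_inP=> x; rewrite inE.
- apply/andP; split=> //; apply/forall_inP=> y /C'D/exists_inP[x xC' xy].
  by apply/exists_inP; exists x => //; apply: (subsetP C'C).
- have [m mC minm] := chain_min CK.
  exists m => D /andP[Dch /forall_inP CD]; apply/andP; split.
    apply: aface_setU1 => // y /CD/exists_inP[x /minm]; exact: le_trans.
  apply/forall_inP=> y; rewrite !inE => /predU1P[->|/CD//].
  by apply/exists_inP; exists m.
Qed.

Lemma acyclic_face_face : acyclic_carrier K K cr_face_face.
Proof.
split=> [|S S' SK /orP[/eqP->|/andP[S0]]|S T S' SK TS|S SK].
- by rewrite /cr_face_face eqxx.
- exact: aface0.
- by apply: aface_sub; apply/face_FG/aface_neq0.
- case/orP=> [S'0|/andP[T0 S'T]]; apply/orP; [by left|right].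
  have S0 : S != set0 by apply: contraNneq T0 => S0; rewrite -subset0 -S0.
  rewrite S0 (subset_trans S'T) //; apply: FG_mono => //.
    exact: aface_neq0 (afaceS TS SK) T0.
  exact: aface_neq0.
- have /set0Pn[w wF] := face_neq0 (face_FG SK).
  exists w => S' SS'; apply/orP; right.
  rewrite face_neq0 //= subUset sub1set wF.
  by case/orP: SS' => [/eqP->|/andP[]//]; apply: sub0set.
Qed.

Lemma galois_homology_iso i :
  isomorphic_zmod (reduced_homology (order_complex L) i) (reduced_homology K i).
Proof.
apply: acyclic_carriers_homology_iso acyclic_chain_face acyclic_face_chain
  acyclic_chain_chain acyclic_face_face _ _ _ _.
- move=> C Cch; apply/andP; split=> //; apply/forall_inP=> x xC.
  by apply/exists_inP; exists x.
- move=> S SK; apply/orP; have [|S0] := eqVneq S set0; [by left|right].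
  by apply/andP; split=> //; apply/sub_FG/aface_neq0.
- move=> C S D _ CS /andP[Dch /forall_inP SD]; apply/andP; split=> //.
  apply/forall_inP=> y /SD/andP[S0 GSy].
  case/orP: CS => [|/exists_inP[x xC SF]].
    by rewrite (negPf S0).
  apply/exists_inP; exists x => //; apply: le_trans GSy; rewrite galois //.
  exact: aface_neq0 (aface_sub (faceF x) SF) S0.
- move=> S C S' SK /andP[_ /forall_inP SC] /orP[S'0|/exists_inP[x xC S'F]].
    by apply/orP; left.
  have /andP[S0 GSx] := SC x xC; apply/orP; right; rewrite S0 /=.
  apply: subset_trans S'F _; apply: (@F_anti (properG_elt (aface_neq0 SK S0))).
  exact: GSx.
Qed.

End Galois.

(** * The external order *)

Section Loops.
Variables (E : finType) (M : matroid E) (S : {set E}).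
Implicit Types A B : {set E}.

Definition loop_indep A := indep M A && [disjoint A & S].

Lemma loop_indep0 : loop_indep set0.
Proof. by rewrite /loop_indep indep0 disjoints_subset sub0set. Qed.

Lemma loop_indepS A B : A \subset B -> loop_indep B -> loop_indep A.
Proof.
by move=> AB /andP[/(indepS AB) iA dB]; rewrite /loop_indep iA (disjointWl AB).
Qed.

Lemma loop_indep_aug A B : loop_indep A -> loop_indep B -> (#|A| < #|B|)%N ->
  exists2 e, e \in B :\: A & loop_indep (e |: A).
Proof.
move=> /andP[iA dA] /andP[iB dB] /(indep_aug iA iB)[e eBA ieA].
exists e => //; rewrite /loop_indep ieA disjoints_subset subUset sub1set inE.
move: eBA; rewrite inE => /andP[_ eB]; rewrite (disjointFr dB) //=.
by rewrite -disjoints_subset.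
Qed.

(* The deletion of [S], kept on the ground set [E] by turning the elements of
   [S] into loops. *)
Definition loop_matroid : matroid E :=
  Matroid loop_indep0 loop_indepS loop_indep_aug.

(** Some base of [M] avoids [S] and stays independent in the deletion, so the deletion has the same
    rank as [M]. *)
Lemma loop_base_base B :
  dual_indep M S -> is_base loop_matroid B -> is_base M B.
Proof.
case/dual_indepP => D bD dSD bB; have /andP[iB _] := base_indep bB.
apply/maxsetP; split=> // A iA BA; apply/eqP; rewrite eq_sym eqEcard BA /=.
apply: leq_trans (indep_card_base iA bD) _; apply: indep_card_base bB.
by rewrite /= /loop_indep (base_indep bD) disjoint_sym.
Qed.

End Loops.

Section ExternalOrder.
Variables (d : Order.disp_t) (E : finOrderType d) (M : matroid E).
Implicit Types (A B S : {set E}) (e : E).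

Lemma loop_circuit S C : circuit (loop_matroid M S) C -> [disjoint C & S] ->
  circuit M C.
Proof.
move=> /minsetP[dC minC] CS; apply/minsetP; split.
  by move: dC; rewrite /= /loop_indep CS andbT.
by move=> D dD DC; apply: minC DC; rewrite /= /loop_indep (negPf dD).
Qed.

Lemma loop_Ext S B e : [disjoint B & S] -> e \notin S ->
  e \in Ext (loop_matroid M S) B -> e \in Ext M B.
Proof.
move=> BS eS; rewrite !inE => /andP[-> /existsP[C /and4P[cC CB eC minC]]].
apply/existsP; exists C; rewrite CB eC minC !andbT; apply: loop_circuit cC _.
apply: disjointWl CB _; rewrite disjoints_subset subUset sub1set inE eS.
by rewrite -disjoints_subset.
Qed.

(** [ext_le_top] gives the inequality in the deletion. It passes to [M] because circuits of the
    deletion that avoid [S] are circuits of [M]. *)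
Lemma ext_le_loop_top S A : dual_indep M S -> is_base M A ->
  [disjoint A & S] -> ext_le M A (top_base (loop_matroid M S)).
Proof.
move=> iS bA AS; set B := top_base _.
have /andP[_ BS] := base_indep (top_base_is_base (loop_matroid M S)).
apply/subsetP => e eA; have := subsetP (ext_le_top (loop_matroid M S) A) e eA.
rewrite !in_setU => /orP[->//|/loop_Ext -> //]; first by rewrite orbT.
by rewrite (disjointFr AS).
Qed.

(** A circuit witnessing activity with respect to [B] also witnesses it with respect to the whole
    ground set. *)
Lemma Ext_top_base B e : e \in Ext M B -> e \notin top_base M.
Proof.
rewrite !inE => /andP[_ /existsP[C /and4P[cC CB eC minC]]].
rewrite andbT negbK; apply/existsP; exists C; rewrite cC eC minC.
by rewrite !andbT; apply/subsetP=> x _; rewrite !inE orbT.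
Qed.

Lemma ext_le_sub_top A B e : ext_le M A B -> e \in top_base M ->
  e \in A -> e \in B.
Proof.
move=> /subsetP AB eT /AB; rewrite in_setU => /orP[//|/Ext_top_base].
by rewrite eT.
Qed.

End ExternalOrder.

Section ExtGalois.
Variables (d : Order.disp_t) (E : finOrderType d) (M : matroid E) (T : {set E}).
Hypothesis T_top : T = top_base M.
Local Notation L := (ext_lattice M).
Local Notation IN := (indep_complex (restr_matroid (dual_matroid M) T)).
Implicit Types (S : {set {x : E | x \in T}}).

Definition top_compl (x : L) : {set {x : E | x \in T}} :=
  if x is Some A then [set v | val v \notin val A] else set0.

(** [insub] returns the bottom [None] if this set is not a base of [M]; by [avoiding_topE] this does
    not occur at faces. *)
Definition avoiding_top (S : {set {x : E | x \in T}}) : L :=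
  insub (top_base (loop_matroid M (val @: S))).

Lemma top_complP (A : base M) S :
  (S \subset top_compl (Some A)) = [disjoint val A & val @: S].
Proof.
rewrite disjoint_sym disjoints_subset.
apply/subsetP/subsetP => [h _ /imsetP[v /h + ->]|h v vS].
  by rewrite !inE.
by have := h (val v) (imset_f _ vS); rewrite !inE.
Qed.

Lemma face_dual_indep S :
  (S \in faces IN) = (S != set0) && dual_indep M (val @: S).
Proof. by rewrite inE. Qed.

(** If [A] avoids [S], then [A <= B] by maximality of [B] in the deletion. Conversely, if [A <= B],
    elements of [T] in [A] remain in [B], which misses [S], and [S] consists of elements of [T]. *)
Lemma avoiding_topE S : S \in faces IN ->
  exists B : base M, [/\ avoiding_top S = Some B, S \subset top_compl (Some B) &
    forall A : base M,
      ((Some A : L) <= (Some B : L))%O = (S \subset top_compl (Some A))].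
Proof.
rewrite face_dual_indep => /andP[_ iS].
have bB := loop_base_base iS (top_base_is_base (loop_matroid M (val @: S))).
have /andP[_ BS] := base_indep (top_base_is_base (loop_matroid M (val @: S))).
pose B : base M := Sub _ bB; exists B.
have SB : S \subset top_compl (Some B) by rewrite top_complP.
split=> [||A] //; first by rewrite /avoiding_top insubT.
apply/idP/idP => [AB|]; last first.
  by rewrite top_complP; apply: ext_le_loop_top (valP A).
apply/subsetP=> v vS; rewrite inE.
have := subsetP SB v vS; rewrite inE; apply: contra.
by apply: ext_le_sub_top AB _; rewrite -T_top; apply: valP.
Qed.

Lemma ext_galois : galois_faces IN top_compl avoiding_top.
Proof.
split=> [[[A|] //= AT]|S SIN|[[A|] //= AT] S SIN].
- rewrite face_dual_indep; apply/andP; split; last first.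
    apply/dual_indepP; exists (val A); first exact: valP.
    by rewrite disjoint_sym -top_complP.
  (* If [T \ A] were empty, [T] would be contained in [A], and equal cardinality of bases would
     force [A = T]. *)
  apply: contraNneq AT => TA; apply/eqP; congr Some; apply: val_inj => /=.
  rewrite -T_top; apply/eqP; rewrite eq_sym eqEcard; apply/andP; split.
    apply/subsetP => e eT; have := in_set0 (exist _ e eT : {x | x \in T}).
    by rewrite -TA inE => /negbFE.
  by rewrite T_top (base_card (valP A) (top_base_is_base M)).
- have [B [-> SB _]] := avoiding_topE SIN; apply/andP; split=> //.
  (* A vertex of [S] lies in [T] but not in [B], so [B] is not the top. *)
  move: SIN; rewrite face_dual_indep => /andP[/set0Pn[v vS] _].
  apply: contraTneq SB => -[->]; apply/subsetPn; exists v => //.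
  by rewrite inE negbK /= -T_top; apply: valP.
- by have [B [-> _ ->]] := avoiding_topE SIN.
Qed.

End ExtGalois.

(** * Maps and homotopies into geometric realizations *)

From mathcomp Require Import classical_sets reals topology normedtype.
Import numFieldNormedType.Exports.

Section RealContinuity.
Variables (R : realType) (T : topologicalType).
Implicit Types f g : T -> R.

Lemma cts_cst (c : R) : continuous (fun _ : T => c).
Proof. by move=> x; apply: cvg_cst. Qed.

Lemma ctsD f g : continuous f -> continuous g ->
  continuous (fun x => f x + g x).
Proof. by move=> cf cg x; apply: cvgD; [apply: cf|apply: cg]. Qed.

Lemma ctsB f g : continuous f -> continuous g ->
  continuous (fun x => f x - g x).
Proof. by move=> cf cg x; apply: cvgB; [apply: cf|apply: cg]. Qed.

Lemma ctsM f g : continuous f -> continuous g ->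
  continuous (fun x => f x * g x).
Proof. by move=> cf cg x; apply: cvgM; [apply: cf|apply: cg]. Qed.

Lemma ctsV f : continuous f -> (forall x, f x != 0) ->
  continuous (fun x => (f x)^-1).
Proof. by move=> cf f0 x; apply: cvgV => //; apply: cf. Qed.

Lemma cts_min f g : continuous f -> continuous g ->
  continuous (fun x => Num.min (f x) (g x)).
Proof.
by move=> cf cg x; apply: (@continuous_min R T f g x); [apply: cf|apply: cg].
Qed.

Lemma cts_max f g : continuous f -> continuous g ->
  continuous (fun x => Num.max (f x) (g x)).
Proof.
by move=> cf cg x; apply: (@continuous_max R T f g x); [apply: cf|apply: cg].
Qed.

Lemma cts_sum (I : finType) (p : pred I) (F : I -> T -> R) :
  (forall i, continuous (F i)) -> continuous (fun x => \sum_(i | p i) F i x).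
Proof.
move=> cF; apply: (@continuous_big R I +%R 0 p) => [x|i _]; last exact: cF.
by apply: cvgD; [apply: cvg_fst|apply: cvg_snd].
Qed.

Lemma cts_prod (I : finType) (p : pred I) (F : I -> T -> R) :
  (forall i, continuous (F i)) -> continuous (fun x => \prod_(i | p i) F i x).
Proof.
move=> cF; apply: (@continuous_big R I *%R 1 p) => [x|i _]; last exact: cF.
by apply: cvgM; [apply: cvg_fst|apply: cvg_snd].
Qed.

End RealContinuity.

Section Realization.
Variables (R : realType) (V : finType) (K : simplicial_complex V).
Local Notation X := (realization R K).

Definition coord (x : X) : V -> R := sval x.

Definition support (y : V -> R) : {set V} := [set v | y v != 0]%SET.

Definition barycentric (y : V -> R) :=
  [/\ forall v, 0 <= y v, \sum_v y v = 1 & support y \in faces K].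

Lemma coordP (x : X) : barycentric (coord x).
Proof. exact: set_mem (proj2_sig x). Qed.

Definition point (y : V -> R) (hy : barycentric y) : X :=
  exist _ y (mem_set hy).

Lemma coord_point y (hy : barycentric y) : coord (point hy) = y.
Proof. by []. Qed.

Lemma coord_inj (x y : X) : coord x =1 coord y -> x = y.
Proof.
case: x y => [x hx] [y hy] /funext /= xy; rewrite /coord /= in xy.
by apply: eq_exist.
Qed.

Lemma in_support (y : V -> R) v : (v \in support y) = (y v != 0).
Proof. by rewrite finset.inE. Qed.

Lemma coord_gt0 x v : v \in support (coord x) -> 0 < coord x v.
Proof.
by rewrite in_support lt_def => ->; case: (coordP x) => + _ _; apply.
Qed.

Lemma cts_coord v : continuous (fun x : X => coord x v).
Proof.
have cval : continuous (sval : X -> prod_topology (fun _ : V => R)).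
  exact: initial_continuous.
move=> x; apply: (@continuous_comp X _ _ sval (fun y => y v)).
  exact: cval.
exact: (@proj_continuous V (fun=> R) v).
Qed.

(** The subspace topology is initial for [sval], and the product topology is the supremum of the
    initial topologies of the coordinates. *)
Lemma cts_realization (Y : topologicalType) (f : Y -> X) :
  (forall v, continuous (fun y => coord (f y) v)) -> continuous f.
Proof.
move=> cf.
have cvf : continuous ((sval \o f) : Y -> prod_topology (fun _ : V => R)).
  move=> y; apply/cvg_sup => v.
  move: y; apply/(@continuousP _ (initial_topology (fun g : V -> R => g v))).
  move=> A [B oB <-].
  by move/continuousP: (cf v) => /(_ B oB).
apply/continuousP => A [B oB <-].
by move/continuousP: cvf => /(_ B oB).
Qed.

Lemma homotopicI (Y : topologicalType) (f g : Y -> X) (h : R -> Y -> V -> R) :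
  (forall v, continuous (fun p : R * Y => h p.1 p.2 v)) ->
  (forall t y, 0 <= t <= 1 -> barycentric (h t y)) ->
  (forall y, h 0 y =1 coord (f y)) -> (forall y, h 1 y =1 coord (g y)) ->
  homotopic R f g.
Proof.
(* Clamping the parameter to the unit interval gives a homotopy defined and continuous on all of
   [R * Y]. *)
move=> ch hb h0 h1; pose cl (t : R) := Num.max 0 (Num.min t 1).
have cl01 t : 0 <= cl t <= 1.
  by rewrite /cl le_max lexx ge_max ler01 ge_min lexx orbT.
exists (fun p : R * Y => point (hb (cl p.1) p.2 (cl01 p.1))); split.
- apply: continuous_subspaceT; apply: cts_realization => v.
  have ccl : continuous (fun p : R * Y => (cl p.1, p.2)).
    have c1 : continuous (fun p : R * Y => cl p.1).
      apply: cts_max; first exact: cts_cst.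
      apply: cts_min; last exact: cts_cst.
      by move=> q; apply: cvg_fst.
    by move=> p; apply: (cvg_pair (c1 p)); exact: cvg_snd.
  by move=> p; apply: (@continuous_comp _ _ _ (fun p : R * Y => (cl p.1, p.2))
    (fun p => h p.1 p.2 v)); [apply: ccl|apply: ch].
- move=> y; apply: coord_inj => v; rewrite coord_point /= -h0 /cl.
  by rewrite (min_idPl _) ?ler01 // maxxx.
- move=> y; apply: coord_inj => v; rewrite coord_point /= -h1 /cl.
  by rewrite minxx (max_idPr _) ?ler01.
Qed.

End Realization.

Lemma support_neq0 (R : realType) (V : finType) (y : V -> R) :
  \sum_v y v = 1 -> support y != finset.set0.
Proof.
move=> y1; apply: contra_eqN y1 => /eqP y_0.
rewrite big1 ?(eq_sym 0) ?oner_eq0 // => v _.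
by apply/eqP; have := in_support y v; rewrite y_0 finset.inE => /esym/negbFE.
Qed.

Lemma barycentricI (R : realType) (V : finType) (K : simplicial_complex V)
    (y : V -> R) (S : {set V}) :
  (forall v, 0 <= y v) -> \sum_v y v = 1 -> S \in faces K ->
  support y \subset S -> barycentric K y.
Proof.
by move=> y0 y1 SK yS; split=> //; apply: facesS yS _ SK; apply: support_neq0.
Qed.

Lemma barycentric_chain (R : realType) (d : Order.disp_t)
    (L : finTBPOrderType d) (y : proper_part L -> R) :
  (forall v, 0 <= y v) -> \sum_v y v = 1 ->
  (forall u v, y u != 0 -> y v != 0 -> (val u >=< val v)%O) ->
  barycentric (order_complex L) y.
Proof.
move=> y0 y1 ych; split=> //; rewrite order_complex_faces support_neq0 //=.
by apply/aface_orderP => u v; rewrite !in_support; apply: ych.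
Qed.

(** * The homotopy equivalence induced by a Galois connection *)

Section GaloisHomotopy.
Variables (R : realType) (d : Order.disp_t) (L : finTBPOrderType d).
Variables (W : finType) (K : simplicial_complex W).
Variables (F : L -> {set W}) (G : {set W} -> L).
Hypothesis FG : galois_faces K F G.
Local Notation P := (proper_part L).
Local Notation X := (realization R (order_complex L)).
Local Notation Y := (realization R K).
Implicit Types (A B D : P) (S : {set W}) (x : X) (y : Y).

Let faceF A : F (val A) \in faces K. Proof. by case: FG. Qed.

Lemma coord_chain x A B : coord x A != 0 -> coord x B != 0 ->
  (val A >=< val B)%O.
Proof.
case: (coordP x) => _ _.
rewrite order_complex_faces => /andP[_ /aface_orderP ch].
by move=> xA xB; apply: ch; rewrite in_support.
Qed.

Lemma coord_nested x A B : coord x A != 0 -> coord x B != 0 ->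
  (F (val A) \subset F (val B)) || (F (val B) \subset F (val A)).
Proof.
move=> xA xB; have /orP[AB|BA] := coord_chain xA xB.
  by rewrite (F_anti FG AB) orbT.
by rewrite (F_anti FG BA).
Qed.

Definition barycenter S w : R := (w \in S)%:R / #|S|%:R.

Lemma barycenter_ge0 S w : 0 <= barycenter S w.
Proof. by rewrite divr_ge0. Qed.

Lemma barycenter_in S w : w \in S -> barycenter S w = #|S|%:R^-1.
Proof. by move=> wS; rewrite /barycenter wS mul1r. Qed.

Lemma barycenter_notin S w : w \notin S -> barycenter S w = 0.
Proof. by move=> wS; rewrite /barycenter (negPf wS) mul0r. Qed.

Lemma sum_barycenter S : S \in faces K -> \sum_w barycenter S w = 1.
Proof.
move=> SK; rewrite -mulr_suml -natr_sum -big_mkcond sum1_card divff //.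
rewrite pnatr_eq0 cards_eq0; apply: contraTneq SK => ->; exact: faces0.
Qed.

Definition face_coord (x : P -> R) w : R :=
  \sum_A x A * barycenter (F (val A)) w.

Lemma face_coordP x : barycentric K (face_coord (coord x)).
Proof.
(* The least vertex [m] of the supporting chain has the largest image, so all the barycenters
   involved lie in the simplex on [F (val m)]. *)
have [x0 x1 xK] := coordP x; have [m _ minm] := chain_min xK.
apply: (barycentricI (S := F (val m))) => [w||//|].
- by apply: sumr_ge0 => A _; rewrite mulr_ge0 ?barycenter_ge0.
- rewrite exchange_big /= -[RHS]x1; apply: eq_bigr => A _.
  by rewrite -mulr_sumr (sum_barycenter (faceF A)) mulr1.
apply/fintype.subsetP => w; rewrite in_support; apply: contraR => wm.
rewrite /face_coord big1 // => A _; have [->|xA] := eqVneq (coord x A) 0.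
  by rewrite mul0r.
rewrite barycenter_notin ?mulr0 //; apply: contra wm; apply/fintype.subsetP.
by apply: (F_anti FG); apply: minm; rewrite in_support.
Qed.

Definition to_faces x : Y := point (face_coordP x).

Lemma cts_to_faces : continuous to_faces.
Proof.
apply: cts_realization => w; apply: cts_sum => A.
by apply: ctsM; [apply: cts_coord|apply: cts_cst].
Qed.

(* For [y >= 0], [level y S] is nonzero exactly when [S] is a superlevel set
   [y > t] with [t >= 0]. *)
Definition level (y : W -> R) S : R :=
  (\prod_(v in S) y v) *
  \prod_(v in S) \prod_(w | w \notin S) Num.max 0 (y v - y w).

Definition level_sum (y : W -> R) := \sum_(S in faces K) level y S.

(** The levels, once normalized, serve as continuous weights on superlevel sets, without sorting the
    coordinates of [y]; each set hands its weight to the vertex [G S]. *)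
Definition chain_coord (y : W -> R) A : R :=
  (\sum_(S in faces K | G S == val A) level y S) / level_sum y.

Lemma level_ge0 y S : 0 <= level (coord y) S.
Proof.
have [y0 _ _] := coordP y; apply: mulr_ge0; first exact: prodr_ge0.
by apply: prodr_ge0 => v _; apply: prodr_ge0 => w _; rewrite le_max lexx.
Qed.

Lemma level_neq0 (y : W -> R) S : level y S != 0 ->
  (forall v, v \in S -> y v != 0) /\
  (forall v w, v \in S -> w \notin S -> y w < y v).
Proof.
rewrite mulf_eq0 negb_or => /andP[/prodf_neq0 yS /prodf_neq0 yS'].
split=> [//|v w vS wS]; have /prodf_neq0/(_ w wS) := yS' v vS.
by apply: contraNT; rewrite -leNgt => yvw; apply/eqP/max_idPl; rewrite subr_le0.
Qed.

(** For [v] in [S] only and [w] in [S'] only, both [y w < y v] and [y v < y w] would hold.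
    Nestedness is what makes the vertices [G S] a chain. *)
Lemma level_nested (y : W -> R) S S' : level y S != 0 -> level y S' != 0 ->
  (S \subset S') || (S' \subset S).
Proof.
move=> /level_neq0[_ yS] /level_neq0[_ yS'].
apply: contraT; rewrite negb_or.
case/andP=> /fintype.subsetPn[v vS vS'] /fintype.subsetPn[w wS' wS].
by have := lt_trans (yS _ _ vS wS) (yS' _ _ wS' vS'); rewrite ltxx.
Qed.

(** The support is the superlevel set at height 0 and is a face, which keeps the denominator of
    [chain_coord] positive. *)
Lemma level_support y : 0 < level (coord y) (support (coord y)).
Proof.
apply: mulr_gt0; first by apply: prodr_gt0 => v; apply: coord_gt0.
apply: prodr_gt0 => v /coord_gt0 yv; apply: prodr_gt0 => w.
by rewrite in_support negbK => /eqP ->; rewrite subr0 lt_max yv orbT.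
Qed.

Lemma level_sum_gt0 y : 0 < level_sum (coord y).
Proof.
have [_ _ yK] := coordP y; rewrite /level_sum (bigD1 _ yK) /=.
apply: ltr_wpDr (level_support y); apply: sumr_ge0 => S _; exact: level_ge0.
Qed.

Lemma chain_coord_neq0 (y : W -> R) A : chain_coord y A != 0 ->
  exists S, [/\ S \in faces K, level y S != 0 & G S = val A].
Proof.
move=> nz; apply: contrapT => no; case/negP: nz.
rewrite /chain_coord big1 ?mul0r // => S /andP[SK /eqP GS].
by apply/eqP; apply: contraT => lS; case: no; exists S.
Qed.

Lemma chain_coordP y : barycentric (order_complex L) (chain_coord (coord y)).
Proof.
apply: barycentric_chain => [A||A B].
- rewrite divr_ge0 ?(ltW (level_sum_gt0 y)) //.
  by apply: sumr_ge0 => S _; apply: level_ge0.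
- rewrite -mulr_suml (exchange_big_dep (mem (faces K))) => [|A S _ /andP[]//].
  rewrite -[RHS](divff (lt0r_neq0 (level_sum_gt0 y))) /=; congr (_ / _).
  apply: eq_bigr => S SK.
  rewrite (big_pred1 (properG_elt FG SK)) // => A /=; rewrite SK /=.
  by rewrite eq_sym -val_eqE.
move=> /chain_coord_neq0[S [SK lS <-]] /chain_coord_neq0[S' [S'K lS' <-]].
rewrite /Order.comparable.
have /orP[SS'|S'S] := level_nested lS lS'.
  by rewrite (G_anti FG SK S'K SS') orbT.
by rewrite (G_anti FG S'K SK S'S).
Qed.

Definition to_chains y : X := point (chain_coordP y).

Lemma cts_to_chains : continuous to_chains.
Proof.
apply: cts_realization => A.
have clevel S : continuous (fun y : Y => level (coord y) S).
  apply: ctsM; first by apply: cts_prod => v; apply: cts_coord.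
  apply: cts_prod => v; apply: cts_prod => w.
  apply: cts_max; first exact: cts_cst.
  by apply: ctsB; apply: cts_coord.
apply: ctsM; first exact: cts_sum.
by apply: ctsV => [|y]; [apply: cts_sum|rewrite lt0r_neq0 ?level_sum_gt0].
Qed.

Lemma cts_comp_snd (T U : topologicalType) (k : T -> R) :
  continuous k -> continuous (fun p : U * T => k p.2).
Proof.
move=> ck p; apply: (@continuous_comp _ _ _ snd k); last exact: ck.
exact: cvg_snd.
Qed.

Lemma cts_fst (T : topologicalType) : continuous (fun p : R * T => p.1).
Proof. by move=> p; apply: cvg_fst. Qed.

(* Both points lie in the simplex on [F (G S)], where [S] is the support of
   [y], so that the segment joining them does. *)
Lemma to_faces_chains_homotopic : homotopic R (to_faces \o to_chains) id.
Proof.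
pose h (t : R) y w :=
  (1 - t) * coord (to_faces (to_chains y)) w + t * coord y w.
apply: (homotopicI (h := h)) => [w|t y /andP[t0 t1]|y w|y w].
- apply: ctsD; apply: ctsM.
  + by apply: ctsB; [apply: cts_cst|apply: cts_fst].
  + apply: (cts_comp_snd (k := fun y => coord (to_faces (to_chains y)) w)).
    move=> y; apply: (@continuous_comp _ _ _ to_chains
      (fun x => coord (to_faces x) w)); first exact: cts_to_chains.
    move: (to_chains y) => x; apply: (@continuous_comp _ _ _ to_faces
      (fun y => coord y w)); first exact: cts_to_faces.
    exact: cts_coord.
  + exact: cts_fst.
  + by apply: (cts_comp_snd (k := fun y => coord y w)); apply: cts_coord.
- have [y0 y1 yK] := coordP y.
  have [z0 z1 _] := coordP (to_faces (to_chains y)).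
  apply: (barycentricI (S := F (G (support (coord y))))) => [w||//|].
  + by rewrite addr_ge0 // mulr_ge0 ?subr_ge0.
  + by rewrite big_split -!mulr_sumr /= y1 z1 !mulr1 subrK.
  + exact: face_FG FG _ yK.
  apply/fintype.subsetP => w; rewrite in_support; apply: contraR => wF.
  have wy : coord y w = 0.
    apply/eqP; move: wF; rewrite -[_ == 0]negbK -in_support; apply: contra.
    exact/fintype.subsetP/(sub_FG FG yK).
  rewrite /h wy mulr0 addr0 coord_point /face_coord big1 ?mulr0 // => A _.
  have [->|] := eqVneq (coord (to_chains y) A) 0; first by rewrite mul0r.
  case/chain_coord_neq0=> S [SK /level_neq0[yS _] <-].
  rewrite barycenter_notin ?mulr0 //; apply: contra wF; apply/fintype.subsetP.
  apply: FG_mono FG _ _ SK yK _; apply/fintype.subsetP => v /yS.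
  by rewrite in_support.
- by rewrite /h subr0 mul1r mul0r addr0.
- by rewrite /h subrr mul0r mul1r add0r.
Qed.

(** The sets [F (val A)] along the chain of [x] are nested and [face_coord] adds positive multiples
    of their indicators, so its superlevel sets are among them. *)
Lemma level_face_coord x S : S \in faces K ->
  level (face_coord (coord x)) S != 0 ->
  exists A, coord x A != 0 /\ S = F (val A).
Proof.
move=> SK /level_neq0[yS ySC]; set y := face_coord (coord x) in yS ySC.
have [x0 _ _] := coordP x.
have /set0Pn[u uS] : S != finset.set0.
  by apply: contraTneq SK => ->; apply: faces0.
(* [v] is a lowest vertex of [S]; the required [A] is the one whose [F (val A)] is smallest among
   those containing [v]. *)
have [v vS minv] := @Order.TotalTheory.arg_minP _ _ _ u (mem S) y uS.
have [A1 /andP[xA1 vA1]] : exists A, (coord x A != 0) && (v \in F (val A)).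
  apply/existsP; apply: contraR (yS v vS) => /existsPn no.
  rewrite /y /face_coord.
  rewrite big1 // => A _; have := no A; rewrite negb_and negbK.
  case/orP=> [/eqP->|vA]; first by rewrite mul0r.
  by rewrite barycenter_notin ?mulr0.
pose p A := (coord x A != 0) && (v \in F (val A)).
have pA1 : p A1 by rewrite /p xA1.
have [A /andP[xA vA] minA] := arg_minnP (fun A => #|F (val A)|) pA1.
exists A; split=> //; apply/eqP; rewrite finset.eqEsubset; apply/andP; split.
  (* Any [F (val B)] containing [w] contains [F (val A)], hence [v], while [A] itself contributes to
     [v] and not to [w]; so [w] would be lower than [v]. *)
  apply/fintype.subsetP => w wS; apply: contraT => wA.
  suff : y w < y v by rewrite ltNge; have /= -> := minv w wS.
  rewrite /y /face_coord (bigD1 A) //= [ltRHS](bigD1 A) //=.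
  rewrite (barycenter_notin wA) mulr0; apply: ltr_leD.
    rewrite barycenter_in // mulr_gt0 ?coord_gt0 ?in_support // invr_gt0 ltr0n.
    by rewrite card_gt0; apply/set0Pn; exists v.
  apply: ler_sum => B _; have [->|xB] := eqVneq (coord x B) 0.
    by rewrite !mul0r.
  apply: ler_wpM2l; first exact: x0.
  have [wB|wB] := boolP (w \in F (val B)); last first.
    by rewrite (barycenter_notin wB) barycenter_ge0.
  suff vB : v \in F (val B) by rewrite !barycenter_in.
  have /orP[/fintype.subsetP BA|/fintype.subsetP AB] := coord_nested xB xA.
    by move: wA; rewrite (BA w wB).
  exact: AB.
(* By the choice of [A], any [F (val B)] containing [v] contains [F (val A)], hence [w]; so [w] is
   at least as high as [v] and cannot lie outside [S]. *)
apply/fintype.subsetP => w wA; apply: contraT => wS.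
suff : y v <= y w by rewrite leNgt ySC.
apply: ler_sum => B _; have [->|xB] := eqVneq (coord x B) 0.
  by rewrite !mul0r.
apply: ler_wpM2l; first exact: x0.
have [vB|vB] := boolP (v \in F (val B)); last first.
  by rewrite (barycenter_notin vB) barycenter_ge0.
suff wB : w \in F (val B) by rewrite !barycenter_in.
have := minA B; rewrite /p xB vB => /(_ isT) leAB.
have /orP[BA|/fintype.subsetP] := coord_nested xB xA; last exact.
have /eqP -> // : F (val B) == F (val A) by rewrite finset.eqEcard BA.
Qed.

Lemma chains_faces_neq0 x D : coord (to_chains (to_faces x)) D != 0 ->
  exists A, coord x A != 0 /\ G (F (val A)) = val D.
Proof.
case/chain_coord_neq0=> S [SK /(level_face_coord SK)[A [xA ->]] <-].
by exists A.
Qed.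

Definition mass_below x A := \sum_(B | (val B < val A)%O) coord x B.

(* Stacking the masses of [x] along its chain, from the bottom up, this is the
   part of the mass at [A] that lies below height [r]. *)
Definition low_mass (r : R) x A :=
  Num.min (coord x A) (Num.max 0 (r - mass_below x A)).

Lemma low_mass_ge0 r x A : 0 <= low_mass r x A.
Proof. by have [x0 _ _] := coordP x; rewrite le_min x0 le_max lexx. Qed.

Lemma low_mass_le r x A : low_mass r x A <= coord x A.
Proof. by rewrite ge_min lexx. Qed.

Lemma mass_below_ge0 x A : 0 <= mass_below x A.
Proof. by have [x0 _ _] := coordP x; apply: sumr_ge0. Qed.

Lemma mass_belowD_le x A (p : pred P) : p A ->
  (forall B, (val B < val A)%O -> p B) ->
  mass_below x A + coord x A <= \sum_(B | p B) coord x B.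
Proof.
have [x0 _ _] := coordP x; move=> pA pB.
rewrite [leRHS](bigD1 A) //= [leLHS]addrC lerD2l.
rewrite /mass_below big_mkcond [leRHS]big_mkcond; apply: ler_sum => B _.
case: ifP => [BA|_]; last by case: ifP.
by rewrite pB // -val_eqE /= lt_eqF.
Qed.

Lemma low_mass1 x A : low_mass 1 x A = coord x A.
Proof.
have [_ x1 _] := coordP x; apply/min_idPl; rewrite le_max lerBrDl.
by rewrite -x1 (@mass_belowD_le x A xpredT) ?orbT.
Qed.

Lemma low_mass_le0 r x A : r <= 0 -> low_mass r x A = 0.
Proof.
move=> r0; have [x0 _ _] := coordP x; rewrite /low_mass (max_idPl _).
  exact/min_idPr.
by rewrite subr_le0 (le_trans r0) ?mass_below_ge0.
Qed.

(** The stack at [A] starts below height [r] and the stack at [B] ends above it; if [B] were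
    strictly below [A], its stack would end no higher than that of [A] starts. *)
Lemma low_high r x A B : low_mass r x A != 0 ->
  low_mass r x B != coord x B -> (val A <= val B)%O.
Proof.
move=> lA hB; have [x0 _ _] := coordP x.
have xA : coord x A != 0.
  by apply: contraNneq lA => xA; rewrite eq_le low_mass_ge0 -xA low_mass_le.
have xB : coord x B != 0.
  by apply: contraNneq hB => xB; rewrite eq_le low_mass_le xB low_mass_ge0.
have {}lA : mass_below x A < r.
  rewrite ltNge; apply: contra lA => rA; rewrite /low_mass (max_idPl _).
    by apply/eqP/min_idPr.
  by rewrite subr_le0.
have {}hB : r < mass_below x B + coord x B.
  rewrite ltNge -lerBrDl; apply: contra hB => hB; apply/eqP/min_idPl.
  by rewrite le_max hB orbT.
have /orP[//|] := coord_chain xA xB; rewrite le_eqVlt => /orP[/eqP->//|BA].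
have := lt_trans lA hB; rewrite ltNge => /negP[].
by apply: mass_belowD_le => // C CB; apply: lt_trans CB BA.
Qed.

(* For [t] from 1 to 1/2 the mass of [x] is moved by the closure operator
   [G o F], the highest mass first, so that the support remains a chain; for
   [t] from 1/2 to 0 both endpoints are supported on the image by [G o F] of
   the support of [x], and the homotopy is linear. *)
Lemma to_chains_faces_homotopic : homotopic R (to_chains \o to_faces) id.
Proof.
(* [s] is the weight of the linear phase and vanishes from [t = 1/2] on; [a] is the mass still in
   place, up to height [2t - 1], and [b] the mass already moved by [G] after [F]. *)
pose s (t : R) := Num.max 0 (1 - (t + t)).
pose a (t : R) := low_mass (t + t - 1).
pose b t x D := \sum_(A : P | G (F (val A)) == val D) (coord x A - a t x A).
pose gf x := coord (to_chains (to_faces x)).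
have cx A : continuous (fun p : R * X => coord p.2 A).
  by apply: (cts_comp_snd (k := fun x => coord x A)); apply: cts_coord.
pose h (t : R) x D := s t * gf x D + (1 - s t) * (a t x D + b t x D).
have c2 : continuous (fun p : R * X => p.1 + p.1).
  by apply: ctsD; apply: cts_fst.
have ca A : continuous (fun p : R * X => a p.1 p.2 A).
  apply: cts_min; first exact: cx.
  apply: cts_max; first exact: cts_cst.
  apply: ctsB; first by apply: ctsB => //; apply: cts_cst.
  apply: cts_sum => B; exact: cx.
have cs : continuous (fun p : R * X => s p.1).
  apply: cts_max; first exact: cts_cst.
  by apply: ctsB => //; apply: cts_cst.
apply: (homotopicI (h := h)) => [D|t x /andP[t0 t1]|x D|x D].
- apply: ctsD; apply: ctsM => //.
  + apply: (cts_comp_snd (k := fun x => gf x D)).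
    move=> x; apply: (@continuous_comp _ _ _ to_faces
      (fun y => coord (to_chains y) D)); first exact: cts_to_faces.
    move: (to_faces x) => y; apply: (@continuous_comp _ _ _ to_chains
      (fun x => coord x D)); first exact: cts_to_chains.
    exact: cts_coord.
  + by apply: ctsB => //; apply: cts_cst.
  + apply: ctsD => //; by apply: cts_sum => A; apply: ctsB.
- have [x0 x1 _] := coordP x.
  have [z0 z1 _] := coordP (to_chains (to_faces x)).
  have s0 : 0 <= s t by rewrite le_max lexx.
  have s1 : 0 <= 1 - s t.
    by rewrite subr_ge0 ge_max ler01 gerBl addr_ge0.
  apply: barycentric_chain => [D||D D'].
  + apply: addr_ge0; apply: mulr_ge0 => //; first exact: z0.
    rewrite addr_ge0 ?low_mass_ge0 //.
    by apply: sumr_ge0 => A _; rewrite subr_ge0 low_mass_le.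
  + have -> : \sum_D h t x D =
        s t * 1 + (1 - s t) * (\sum_A a t x A + \sum_D b t x D).
      by rewrite big_split -!mulr_sumr /= z1 big_split.
    have -> : \sum_D b t x D = \sum_A (coord x A - a t x A).
      rewrite (exchange_big_dep predT) //=; apply: eq_bigr => A _.
      by rewrite (big_pred1 (properG_elt FG (faceF A))).
    by rewrite sumrB x1 addrC; ring.
  have hP C : h t x C != 0 -> a t x C != 0 \/ exists A,
      [/\ coord x A != 0, a t x A != coord x A \/ s t != 0 &
          G (F (val A)) = val C].
    have [sgf|/[swap] _] := eqVneq (s t * gf x C) 0; last first.
      rewrite mulf_eq0 negb_or => /andP[st /chains_faces_neq0[A [xA AC]]].
      by right; exists A; split=> //; right.
    rewrite /h sgf add0r mulf_eq0 negb_or => /andP[_].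
    have [->|aC _] := eqVneq (a t x C) 0; last by left.
    rewrite add0r => bC; right; apply: contrapT => no; case/negP: bC.
    rewrite /b big1 // => A /eqP AC; apply/eqP; rewrite subr_eq0 eq_sym.
    apply: contraT => aA; case: no; exists A; split=> //; last by left.
    by apply: contraNneq aA => xA; rewrite eq_le low_mass_le xA low_mass_ge0.
  (* Mass still in place lies below the images: [C <= A <= G (F A)], the first inequality by
     [low_high]. If [s t] is nonzero, then [t < 1/2] and no mass is in place. *)
  have ab C C' : a t x C != 0 -> (exists A,
      [/\ coord x A != 0, a t x A != coord x A \/ s t != 0 &
          G (F (val A)) = val C']) -> (val C <= val C')%O.
    move=> aC [A [xA hA <-]]; apply: le_trans (le_GF FG A).
    apply: (low_high aC); case: hA => // st.
    case/negP: aC; apply/eqP/low_mass_le0; rewrite subr_le0 leNgt.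
    apply: contra st => t12; apply/eqP/max_idPl; rewrite subr_le0; exact: ltW.
  rewrite /Order.comparable => /hP[aD|bD] /hP[aD'|bD'].
  + have ne C : a t x C != 0 -> coord x C != 0.
      by apply: contraNneq => xC; rewrite eq_le low_mass_ge0 -xC low_mass_le.
    by apply: coord_chain; apply: ne.
  + by rewrite ab.
  + by rewrite orbC ab.
  + case: bD bD' => A [xA _ <-] [A' [xA' _ <-]].
    have GF_mono B B' : (val B <= val B')%O ->
        (G (F (val B)) <= G (F (val B')))%O.
      by move=> /(F_anti FG); apply: (G_anti FG).
    have /orP[/GF_mono->//|/GF_mono->] := coord_chain xA xA'.
    by rewrite orbT.
- rewrite /h /s addr0 subr0 (max_idPr ler01) subrr mul0r addr0 mul1r.
  by [].
- rewrite /h; have -> : s 1 = 0 by apply/max_idPl; rewrite subr_le0 lerDl.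
  rewrite mul0r add0r subr0 mul1r /b.
  have a1 A : a 1 x A = coord x A by rewrite /a addrK low_mass1.
  by rewrite a1 big1 ?addr0 // => A _; rewrite a1 subrr.
Qed.

Lemma galois_homotopy_equivalent : homotopy_equivalent R X Y.
Proof.
exists to_faces, to_chains; split.
- exact: cts_to_faces.
- exact: cts_to_chains.
- exact: to_chains_faces_homotopic.
- exact: to_faces_chains_homotopic.
Qed.

End GaloisHomotopy.

Theorem theorem3p1 (R : realType) (d : Order.disp_t) (E : finOrderType d)
    (M : matroid E) (T : base M)
    (hT : forall x : ext_lattice M, (x <= (Some T : ext_lattice M))%O) :
  homotopy_equivalent R
    (realization R (Delta M))
    (realization R
      (indep_complex (restr_matroid (dual_matroid M) (val T)))) /\
  (forall i : int, -1 <= i ->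
    isomorphic_zmod
      (reduced_homology (Delta M) i)
      (reduced_homology
        (indep_complex (restr_matroid (dual_matroid M) (val T))) i)).
Proof.
have FG := ext_galois (ext_lattice_maxE hT).
split=> [|i _]; first exact: galois_homotopy_equivalent FG.
exact: galois_homology_iso FG i.
Qed.
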